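(* Let $Q\subset\mathbb{R}^2$ be a convex quadrilateral whose diagonals are perpendicular and both of euclidean length $1$ (so $\operatorname{area} Q=1/2$). Then every $Q$-cover has area at least $1$, and the unit square with sides parallel to the diagonals of $Q$ is a $Q$-cover (of area exactly $1$).
   Context: For $x\in\mathbb{R}^2$ let $\|x\|_Q=\max_{y\in Q}\langle x,y\rangle$ (closed-curve lengths below are unchanged by translating $Q$, so one may assume the origin is interior to $Q$). A non-degenerate triangle is $Q$-normal if its boundary can be oriented $u\to v\to w\to u$ so that the directions of $v-u$, $w-v$, $u-w$ are outward normal directions of sides of $Q$ and $\|v-u\|_Q+\|w-v\|_Q+\|u-w\|_Q=1$; a segment $[u,v]$ is $Q$-normal if the directions of $v-u$ and $u-v$ are outward normal directions of sides of $Q$ and $\|v-u\|_Q+\|u-v\|_Q=1$. A set $A$ fits into $B$ if $A+t\subset B$ for some $t$. A $Q$-cover is a convex shape (compact convex set with non-empty interior) $K\subset\mathbb{R}^2$ into which every $Q$-normal triangle (degenerate or not) fits. *)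

(* Defs.v *)
From mathcomp Require Import all_boot all_order all_algebra.
From mathcomp Require Import all_classical all_reals all_analysis.
Set Implicit Arguments. Unset Strict Implicit. Unset Printing Implicit Defensive.
Import Order.TTheory GRing.Theory Num.Theory.
Local Open Scope classical_set_scope.
Local Open Scope ring_scope.

Section Plane.
Variable R : realType.
Local Notation pt := (R^o * R^o)%type.

Definition padd (p q : pt) : pt := (p.1 + q.1, p.2 + q.2).
Definition psub (p q : pt) : pt := (p.1 - q.1, p.2 - q.2).
Definition pscale (a : R) (p : pt) : pt := (a * p.1, a * p.2).
Definition dot (p q : pt) : R := p.1 * q.1 + p.2 * q.2.
Definition cross (p q : pt) : R := p.1 * q.2 - p.2 * q.1.
Definition rotcw (p : pt) : pt := (p.2, - p.1).

Definition hull (s : seq pt) : set pt :=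
  [set z | exists l : seq R, [/\ size l = size s, all (fun a => 0 <= a) l,
     \sum_(a <- l) a = 1 &
     z = foldr padd (0, 0) [seq pscale a.1 a.2 | a <- zip l s]]].

Definition convex_quad_ccw (p : 'I_4 -> pt) : Prop :=
  forall i : 'I_4,
    0 < cross (psub (p (i + 1)%R) (p i)) (psub (p (i + 2%:R)%R) (p (i + 1)%R)).

Definition quad (p : 'I_4 -> pt) : set pt := hull [:: p 0; p 1; p 2%:R; p 3%:R].

Definition Qnorm (Q : set pt) (x : pt) : R := sup [set dot x y | y in Q].

(* d is an outward normal direction of the side [p i, p (i+1)] of the ccw quadrilateral *)
Definition outward_normal_dir (p : 'I_4 -> pt) (d : pt) : Prop :=
  exists i : 'I_4, exists2 lam : R, 0 < lam &
    d = pscale lam (rotcw (psub (p (i + 1)%R) (p i))).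

Definition Qnormal_triangle (p : 'I_4 -> pt) (u v w : pt) : Prop :=
  cross (psub v u) (psub w u) != 0 /\
  outward_normal_dir p (psub v u) /\ outward_normal_dir p (psub w v) /\
  outward_normal_dir p (psub u w) /\
  Qnorm (quad p) (psub v u) + Qnorm (quad p) (psub w v) + Qnorm (quad p) (psub u w) = 1.

Definition Qnormal_segment (p : 'I_4 -> pt) (u v : pt) : Prop :=
  outward_normal_dir p (psub v u) /\ outward_normal_dir p (psub u v) /\
  Qnorm (quad p) (psub v u) + Qnorm (quad p) (psub u v) = 1.

Definition fits (A B : set pt) : Prop :=
  exists t : pt, [set padd a t | a in A] `<=` B.

Definition convex_set (K : set pt) : Prop :=
  forall x y, K x -> K y -> forall t : R, 0 <= t <= 1 ->
    K (padd (pscale (1 - t) x) (pscale t y)).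

Definition convex_shape (K : set pt) : Prop :=
  convex_set K /\ compact K /\ interior K !=set0.

Definition Qcover (p : 'I_4 -> pt) (K : set pt) : Prop :=
  convex_shape K /\
  (forall u v w, Qnormal_triangle p u v w -> fits (hull [:: u; v; w]) K) /\
  (forall u v, Qnormal_segment p u v -> fits (hull [:: u; v]) K).

Definition area (K : set pt) : \bar R :=
  ((@lebesgue_measure R) \x (@lebesgue_measure R))%E K.

Definition square (c e1 e2 : pt) : set pt :=
  [set z | exists s t : R, [/\ 0 <= s <= 1, 0 <= t <= 1 &
     z = padd c (padd (pscale s e1) (pscale t e2))]].
End Plane.

(* Main.v *)
Require Import Defs.
From mathcomp Require Import all_boot all_order all_algebra.
From mathcomp Require Import all_classical all_reals all_analysis.
From mathcomp Require Import measurable_realfun ring lra.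
Import Order.TTheory GRing.Theory Num.Theory.
Import numFieldTopology.Exports numFieldNormedType.Exports.
Local Open Scope classical_set_scope.
Local Open Scope ring_scope.

(* Let E1, E2 be the diagonals, split by their intersection into lengths a, b and
   c, d with a + b = c + d = 1, and relabel cyclically so that c is the largest.
   In the frame (E1, E2) the Q-normal triangles with normals at three consecutive
   sides are, up to translation, the triangle T with vertices 0, (1, a/c), (d/b, 1),
   the triangle T' with vertices 0, (-1, b/c), (-d/a, 1), and -T, -T' (segments in
   the boundary cases). They all have bounding box the unit square, and a Q-cover
   contains a translate of each of them.

   Half-differences of opposite sections in a suitable direction turn a cover into
   a centrally symmetric convex set of no larger area, still containing translates
   of the four triangles; now -T and -T' are placed symmetrically to T and T', and
   only the corners X of -T and Y of -T' remain as parameters. Signed areas of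
   centrally symmetric octagons with vertices in a symmetric convex set are at most
   the area of the set, in whatever order the vertices come, and so are those of
   decagons that are monotone in some direction. A few such polygons on the corners
   of the triangles always suffice to give area at least 1.

   For the square, 1 = |x|_Q + |y|_Q + |z|_Q with x + y + z = 0 gives, on bounding
   the norms below by products with the endpoints of a diagonal E, that
   |<x, E>| <= 1; hence the triangle has extent at most 1 along both diagonals. *)

(** * Area of plane sets *)

Lemma lebesgue_measure_shift (R : realType) (k : R) (A : set R) :
  measurable A ->
  lebesgue_measure ((fun x => x + k) @^-1` A) = lebesgue_measure A.
Proof.
move=> mA.
have mk : measurable_fun setT (fun x : measurableTypeR R => x + k : measurableTypeR R).
  exact: measurable_funD.
suff -> : lebesgue_measure A = pushforward lebesgue_measure
    (fun x : measurableTypeR R => x + k : measurableTypeR R) A by [].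
apply: lebesgue_measure_unique => //= _ [[a b]] _ <-.
rewrite /pushforward.
have -> : (fun x : measurableTypeR R => x + k) @^-1` `]a, b]%classic =
    `](a - k), (b - k)]%classic.
  by apply/seteqP; split=> x /=; rewrite !in_itv/= ltrBlDr lerBrDr.
by rewrite !lebesgue_measure_itv/= !lte_fin ltrD2r -!EFinD opprB addrA subrK.
Qed.

Section planar.
Variable R : realType.
Local Notation pt := (R^o * R^o)%type.
Implicit Types (K : set pt) (z w : pt).

(** An open set is the countable union of the rational open boxes that it contains. This connects
    the topology with the product sigma-algebra on which [area] is computed. *)
Lemma open_measurable_plane (U : set pt) : open U ->
  measurable (U : set (measurableTypeR R * measurableTypeR R)%type).
Proof.
move=> oU.
pose F (i : (rat * rat) * (rat * rat)) : set pt :=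
  let B := `]ratr i.1.1, ratr i.1.2[%classic `*` `]ratr i.2.1, ratr i.2.2[%classic in
  if pselect (B `<=` U) then B else set0.
have -> : U = \bigcup_i F i.
  apply/seteqP; split => [[x y] Uxy|z [i _]]; last first.
    by rewrite /F; case: pselect => [BU|//] /= /BU.
  have /nbhs_ballP[e /= e0 eU] : nbhs (x, y) U by exact: open_nbhs_nbhs.
  have [q1] := @rat_in_itvoo _ (x - e) x ltac:(lra).
  have [q2] := @rat_in_itvoo _ x (x + e) ltac:(lra).
  have [q3] := @rat_in_itvoo _ (y - e) y ltac:(lra).
  have [q4] := @rat_in_itvoo _ y (y + e) ltac:(lra).
  rewrite !in_itv/= => /andP[h1 h2] /andP[h3 h4] /andP[h5 h6] /andP[h7 h8].
  exists ((q1, q2), (q3, q4)) => //; rewrite /F /=.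
  set B := (X in X `<=` U).
  have BU : B `<=` U.
    move=> [a b] [] /=; rewrite !in_itv/= => /andP[a1 a2] /andP[b1 b2].
    by apply: eU; split; rewrite /= /ball/= ltr_norml; apply/andP; split; lra.
  case: pselect => [?|//] /=.
  by split; rewrite /= in_itv/=; apply/andP; split.
apply: countable_bigcupT_measurable => // i; rewrite /F.
case: pselect => [?|?] /=; last exact: measurable0.
by apply: measurableX; exact: measurable_itv.
Qed.

Lemma closed_measurable_plane K : closed K ->
  measurable (K : set (measurableTypeR R * measurableTypeR R)%type).
Proof. by move=> /closed_openC/open_measurable_plane/measurableC; rewrite setCK. Qed.

End planar.

(** * Area-preserving maps of the plane *)

Section planar.
Variable R : realType.
Local Notation pt := (R^o * R^o)%type.
Local Notation mR := (measurableTypeR R).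
Local Notation mpt := (mR * mR)%type.
Implicit Types (K : set pt) (z w : pt).

Definition linmap (a b c d : R) (z : pt) : pt := (a * z.1 + b * z.2, c * z.1 + d * z.2).

Definition area_preserving (f : pt -> pt) : Prop :=
  forall K, measurable (K : set mpt) ->
    measurable (f @^-1` K : set mpt) /\ area (f @^-1` K) = area K.

Lemma area_preserving_comp (f g : pt -> pt) :
  area_preserving f -> area_preserving g -> area_preserving (f \o g).
Proof.
move=> hf hg K mK; have [mfK afK] := hf _ mK.
by rewrite comp_preimage; have [? ->] := hg _ mfK.
Qed.

Lemma ge0_integral_shift (k : R) (g : R -> \bar R) :
  measurable_fun setT (g : mR -> \bar R) -> (forall x, 0 <= g x)%E ->
  (\int[@lebesgue_measure R]_x g (x + k)%R = \int[@lebesgue_measure R]_x g x)%E.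
Proof.
move=> mg g0.
have mk : measurable_fun setT (fun x : mR => x + k : mR) by exact: measurable_funD.
transitivity (\int[pushforward lebesgue_measure (fun x : mR => (x + k)%R : mR)]_x g x)%E.
  by rewrite ge0_integral_pushforward//; exact: measurable_funTS.
by apply: eq_measure_integral => A mA _; exact: lebesgue_measure_shift.
Qed.

Lemma area_preserving_translation (t : pt) : area_preserving (padd t).
Proof.
move=> K mK; have mt : measurable_fun setT (padd t : mpt -> mpt).
  by apply: measurable_fun_pair; apply: measurable_funD => //=;
    (exact: measurable_fst || exact: measurable_snd).
split; first by rewrite -[X in measurable X]setTI; exact: mt.
rewrite /area /product_measure1/=.
rewrite -(ge0_integral_shift t.1 (lebesgue_measure \o xsection K)%E)//; last first.
  exact: measurable_fun_xsection.
apply: eq_integral => x _ /=.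
rewrite -[RHS](lebesgue_measure_shift _ t.2); last exact: (@measurable_xsection _ _ mR mR).
congr (lebesgue_measure _); apply/seteqP; split=> y; rewrite /xsection/= !inE /= /padd /=;
 by rewrite (addrC x) (addrC y).
Qed.

(** Each vertical section is merely translated, so the integrand stays the same. *)
Lemma area_preserving_shear_y (k : R) : area_preserving (linmap 1 0 k 1).
Proof.
move=> K mK; have mt : measurable_fun setT (linmap 1 0 k 1 : mpt -> mpt).
  by apply: measurable_fun_pair; apply: measurable_funD => //=;
    apply: measurable_funM => //; (exact: measurable_fst || exact: measurable_snd).
split; first by rewrite -[X in measurable X]setTI; exact: mt.
apply: eq_integral => x _ /=.
rewrite -[RHS](lebesgue_measure_shift _ (k * x)); last exact: (@measurable_xsection _ _ mR mR).
congr (lebesgue_measure _); apply/seteqP; split=> y; rewrite /xsection/= !inE /= /linmap /=;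
 by rewrite !mul1r mul0r addr0 addrC.
Qed.

Lemma areaE_ysection K : measurable (K : set mpt) ->
  area K = (\int[lebesgue_measure]_y lebesgue_measure (ysection K y))%E.
Proof.
move=> mK; transitivity ((@lebesgue_measure R \x^ @lebesgue_measure R)%E K) => //.
by apply: product_measure_unique => //= *; rewrite product_measure2E.
Qed.

(** Here the horizontal sections are translated, so the order of integration is exchanged first. *)
Lemma area_preserving_shear_x (k : R) : area_preserving (linmap 1 k 0 1).
Proof.
move=> K mK; have mt : measurable_fun setT (linmap 1 k 0 1 : mpt -> mpt).
  by apply: measurable_fun_pair; apply: measurable_funD => //=;
    apply: measurable_funM => //; (exact: measurable_fst || exact: measurable_snd).
have mK' : measurable (linmap 1 k 0 1 @^-1` K : set mpt).
  by rewrite -[X in measurable X]setTI; exact: mt.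
split=> //; rewrite !areaE_ysection//.
apply: eq_integral => y _ /=.
rewrite -[RHS](lebesgue_measure_shift _ (k * y)); last exact: (@measurable_ysection _ _ mR mR).
congr (lebesgue_measure _); apply/seteqP; split=> x; rewrite /ysection/= !inE /= /linmap /=;
 by rewrite !mul1r mul0r add0r.
Qed.

(* Every matrix of determinant one is a product of at most four shears. *)
Lemma area_preserving_linmap (a b c d : R) :
  a * d - b * c = 1 -> area_preserving (linmap a b c d).
Proof.
have main a' b' c' d' : c' != 0 -> a' * d' - b' * c' = 1 ->
    area_preserving (linmap a' b' c' d').
  move=> c0 det.
  have -> : linmap a' b' c' d' = linmap 1 ((a' - 1) / c') 0 1 \o
      (linmap 1 0 c' 1 \o linmap 1 ((d' - 1) / c') 0 1).
    apply/funext => -[x y]; rewrite /linmap/=.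
    have -> : b' = (a' * d' - 1) / c' by apply: (mulIf c0); rewrite mulfVK// -det; ring.
    by congr pair; field.
  apply: area_preserving_comp; first exact: area_preserving_shear_x.
  apply: area_preserving_comp; first exact: area_preserving_shear_y.
  exact: area_preserving_shear_x.
move=> det; have [c0|/main] := eqVneq c 0; last exact.
have a0 : a != 0 by apply: contra_eqN det => /eqP->; rewrite c0; lra.
(* Splitting off a shear makes the lower left entry [d], which is nonzero because [a * d = 1]. *)
have -> : linmap a b c d = linmap (a + b) b d d \o linmap 1 0 (-1) 1.
  by apply/funext => -[x y]; rewrite /linmap/= c0; congr pair; ring.
apply: area_preserving_comp; last exact: area_preserving_shear_y.
apply: main; last by rewrite -det c0; ring.
by apply: contra_eqN det => /eqP->; rewrite c0; lra.
Qed.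

End planar.

(** * Polygons inside convex sets *)

Section affine.
Variable R : realType.
Local Notation mu := (@lebesgue_measure R).

Lemma integrable_affine (a b k m : R) :
  mu.-integrable `[a, b[ (EFin \o (fun x => k * x + m)).
Proof.
apply: (@integrableS _ (measurableTypeR R) _ mu `[a, b]%classic) => //.
  by apply: subset_itv; rewrite bnd_simp.
apply: continuous_compact_integrable; first exact: segment_compact.
apply: continuous_subspaceT => x; apply: cvgD; last exact: cvg_cst.
by apply: cvgM; [exact: cvg_cst|exact: cvg_id].
Qed.

Lemma integral_affine (a b k m : R) : a <= b ->
  (\int[mu]_(x in `[a, b[) (k * x + m)%:E =
   ((b - a) * (k * (a + b) / 2 + m))%:E)%E.
Proof.
rewrite le_eqVlt => /predU1P[<-|ab].
  by rewrite set_itvco0 integral_set0 subrr mul0r.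
have dF (x : R) : is_derive x 1 (fun x : R => k / 2 * x ^+ 2 + m * x) (k * x + m).
  apply: is_derive_eq; rewrite /GRing.scale/=; lra.
have cf : continuous (fun x : R => k * x + m).
  move=> x; apply: cvgD; last exact: cvg_cst.
  by apply: cvgM; [exact: cvg_cst|exact: cvg_id].
have cF (x : R) : {for x, continuous (fun x : R => k / 2 * x ^+ 2 + m * x)}.
  by apply: differentiable_continuous; apply/derivable1_diffP; case: (dF x).
rewrite integral_itv_bndo_bndc; last first.
  apply/measurable_EFinP; apply: measurable_funTS; exact: continuous_measurable_fun.
rewrite (@continuous_FTC2 _ _ (fun x : R => k / 2 * x ^+ 2 + m * x))//.
- by rewrite -EFinB; congr EFin; lra.
- exact: continuous_subspaceT.
- split.
  + by move=> x _; case: (dF x).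
  + apply: cvg_at_right_filter; exact: cF.
  + apply: cvg_at_left_filter; exact: cF.
- by move=> x _; rewrite derive1E; case: (dF x).
Qed.
End affine.

Section planar.
Variable R : realType.
Local Notation pt := (R^o * R^o)%type.
Local Notation mR := (measurableTypeR R).
Local Notation mpt := (mR * mR)%type.
Local Notation mu := (@lebesgue_measure R).
Implicit Types (K : set pt) (z w : pt).

(* The signed area between the broken line z :: s and the first axis. *)
Fixpoint trap (z : pt) (s : seq pt) : R :=
  if s is w :: s' then (w.1 - z.1) * (z.2 + w.2) / 2 + trap w s' else 0.

Definition xle : rel pt := fun z w => z.1 <= w.1.

Lemma path_xle_last z (s : seq pt) : path xle z s -> z.1 <= (last z s).1.
Proof.
by elim: s z => //= w s IH z /andP[zw /IH]; exact: le_trans.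
Qed.

(** [t] is the piecewise affine function with the broken line as its graph, extended by 0. Half-open
    ranges let the pieces be added up without overlap at the vertices. *)
Lemma broken_line_graph K z (s : seq pt) : Defs.convex_set K -> K z ->
  {in s, forall w, K w} -> path xle z s ->
  exists t : R -> R, [/\ mu.-integrable setT (EFin \o t),
    (\int[mu]_x (t x)%:E = (trap z s)%:E)%E,
    forall x, z.1 <= x < (last z s).1 -> K (x, t x) &
    forall x, ~~ (z.1 <= x < (last z s).1) -> t x = 0].
Proof.
move=> cK; elim: s z => [|w s IH] z Kz Ks.
  move=> _; exists (fun=> 0); split => //=.
  - exact: integrable0.
  - by rewrite integral0.
  - by move=> x /andP[h /(le_lt_trans h)]; rewrite ltxx.
move=> /=/andP[zw ps].
have Kw : K w by apply: Ks; rewrite mem_head.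
have [|t [it intt tK t0]] := IH w Kw _ ps.
  by move=> q qs; apply: Ks; rewrite inE qs orbT.
have wl := path_xle_last _ _ ps.
(* For a vertical edge the division by zero gives [k = 0], and [I] is empty, so the edge contributes
   nothing. *)
pose k := (w.2 - z.2) / (w.1 - z.1).
pose I := `[z.1, w.1[%classic : set R.
pose f x := k * x + (z.2 - k * z.1).
have iI : mu.-integrable setT (EFin \o (f \_ I)).
  rewrite -restrict_EFin; apply/(integrable_mkcond _ _).1; first exact: measurable_itv.
  exact: (integrable_affine _ z.1 w.1 k (z.2 - k * z.1)).
exists ((f \_ I) \+ t); split.
- by rewrite (_ : _ \o _ = (EFin \o (f \_ I)) \+ (EFin \o t))%E//; exact: integrableD.
- under eq_integral do rewrite EFinD.
  rewrite integralD_EFin// intt.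
  have -> : (\int[mu]_x (f \_ I x)%:E = \int[mu]_(x in I) (f x)%:E)%E.
    rewrite [RHS]integral_mkcond; apply: eq_integral => x _.
    by rewrite !patchE; case: ifP.
  rewrite integral_affine// -EFinD; congr (_ + _)%:E.
  have [e|ne] := eqVneq w.1 z.1; first by rewrite e; lra.
  by rewrite /k; field; rewrite subr_eq0.
- move=> x /andP[zx xl]; rewrite /= patchE /I mem_setE/= in_itv/= zx/=.
  case: ltP => xw.
    rewrite t0 ?addr0; last by rewrite negb_and -ltNge xw.
    have zw' : 0 < w.1 - z.1 by rewrite subr_gt0; exact: le_lt_trans xw.
    have := cK z w Kz Kw ((x - z.1) / (w.1 - z.1)).
    have -> : padd (pscale (1 - (x - z.1) / (w.1 - z.1)) z)
        (pscale ((x - z.1) / (w.1 - z.1)) w) = (x, f x).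
      by rewrite /padd/pscale/f/k/=; congr pair; field; rewrite gt_eqF.
    apply; apply/andP; split; first by apply: divr_ge0; lra.
    by rewrite ler_pdivrMr//; lra.
  by rewrite add0r; apply: tK; rewrite xw.
- move=> x nx; rewrite /= patchE /I mem_setE/= in_itv/= t0 ?addr0.
    case: ifP => // /andP[zx xw]; move: nx.
    by rewrite zx (lt_le_trans xw wl).
  apply: contra nx => /andP[wx ->]; by rewrite (le_trans zw wx).
Qed.

(* Vertical sections are longer than the gap between the two broken lines; no
   assumption is needed on whether these cross each other. *)
Lemma area_ge_between K z (u l : seq pt) : Defs.convex_set K ->
  measurable (K : set mpt) -> K z ->
  {in u, forall w, K w} -> {in l, forall w, K w} ->
  path xle z u -> path xle z l -> (last z u).1 = (last z l).1 ->
  ((trap z u - trap z l)%:E <= area K)%E.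
Proof.
move=> cK mK Kz Ku Kl pu pl ul.
have [tu [iu intu uK u0]] := broken_line_graph _ _ _ cK Kz Ku pu.
have [tl [il intl lK l0]] := broken_line_graph _ _ _ cK Kz Kl pl.
have [->|afin] := eqVneq (area K) +oo%E; first exact: leey.
pose g (x : R) := mu (xsection K x).
have ig : mu.-integrable setT g.
  apply/integrableP; split; first exact: measurable_fun_xsection.
  by under eq_integral do rewrite gee0_abs ?measure_ge0//; rewrite ltey.
rewrite EFinB -intu -intl -integralB_EFin//.
apply: le_integral => //; first exact: integrableB.
move=> x _; rewrite -EFinB.
have [xz|xz] := boolP (z.1 <= x < (last z u).1); last first.
  by rewrite u0// l0 -?ul// subrr measure_ge0.
have [tul|] := leP (tu x) (tl x).
  by apply: le_trans (measure_ge0 _ _); rewrite lee_fin subr_le0.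
move=> ltu; have -> : (tu x - tl x)%:E = mu `[tl x, tu x]%classic.
  by rewrite lebesgue_measure_itv/= lte_fin ltu.
apply: le_measure; rewrite ?inE//; first exact: (@measurable_xsection _ _ mR mR).
move=> y /=; rewrite in_itv/= => /andP[ly yu]; rewrite /xsection/= inE.
have := cK _ _ (lK x _) (uK x xz) ((y - tl x) / (tu x - tl x)); rewrite -ul => /(_ xz).
have -> : padd (pscale (1 - (y - tl x) / (tu x - tl x)) (x, tl x))
    (pscale ((y - tl x) / (tu x - tl x)) (x, tu x)) = (x, y).
  by rewrite /padd/pscale/=; congr pair; field; rewrite gt_eqF// subr_gt0.
apply; apply/andP; split; first by apply: divr_ge0; lra.
by rewrite ler_pdivrMr; lra.
Qed.

End planar.

(** * Monotone centrally symmetric decagons *)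

Section decagon.
Variable R : realType.
Local Notation pt := (R^o * R^o)%type.
Local Notation mR := (measurableTypeR R).
Local Notation mpt := (mR * mR)%type.
Implicit Types (K : set pt) (z w p q : pt).

Definition popp z : pt := (- z.1, - z.2).

Definition centrally_symmetric K := forall z, K z -> K (popp z).

(* The signed area of the closed polygon z0 z1 z2 z3 z4 -z0 -z1 -z2 -z3 -z4. *)
Definition decagon z0 z1 z2 z3 z4 : R :=
  cross z0 z1 + cross z1 z2 + cross z2 z3 + cross z3 z4 + cross z0 z4.

Definition octagon z0 z1 z2 z3 : R :=
  cross z0 z1 + cross z1 z2 + cross z2 z3 + cross z0 z3.

(** The boundary splits at [z0] and its opposite into two broken lines, one through [z4], ..., [z1]
    and one through the opposites of [z1], ..., [z4]; the difference of their trapezoid sums is the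
    signed area. *)
Lemma area_ge_decagon_x K z0 z1 z2 z3 z4 :
  Defs.convex_set K -> measurable (K : set mpt) -> centrally_symmetric K ->
  K z0 -> K z1 -> K z2 -> K z3 -> K z4 ->
  [/\ z1.1 <= z0.1, z2.1 <= z1.1, z3.1 <= z2.1, z4.1 <= z3.1 & - z0.1 <= z4.1] ->
  ((decagon z0 z1 z2 z3 z4)%:E <= area K)%E.
Proof.
move=> cK mK sK K0 K1 K2 K3 K4 [h1 h2 h3 h4 h5].
have := @area_ge_between R K (popp z0) [:: z4; z3; z2; z1; z0]
  [:: popp z1; popp z2; popp z3; popp z4; z0] cK mK (sK _ K0).
have -> : trap _ (popp z0) [:: z4; z3; z2; z1; z0] -
    trap _ (popp z0) [:: popp z1; popp z2; popp z3; popp z4; z0] =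
    decagon z0 z1 z2 z3 z4.
  by rewrite /decagon/trap/cross/popp/=; field.
apply => //.
- by move=> w; rewrite !inE => /orP[|/orP[|/orP[|/orP[|]]]] /eqP->.
- by move=> w; rewrite !inE => /orP[|/orP[|/orP[|/orP[|]]]] /eqP-> //; exact: sK.
- by rewrite /= /xle/=; lra.
- by rewrite /= /xle/=; lra.
Qed.

Lemma exists_dual p : p != (0, 0) -> exists r : pt, cross p r = 1.
Proof.
move=> p0; have n0 : p.1 ^+ 2 + p.2 ^+ 2 != 0.
  apply: contra p0; rewrite paddr_eq0 ?sqr_ge0// !sqrf_eq0 => /andP[/eqP p1 /eqP p2].
  by rewrite [p]surjective_pairing p1 p2.
exists (- p.2 / (p.1 ^+ 2 + p.2 ^+ 2), p.1 / (p.1 ^+ 2 + p.2 ^+ 2)).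
by rewrite /cross/=; field.
Qed.

(** If [cross p r = 1], then [z] is [cross z r] times [p] minus [cross z p] times [r]. With
    [cross z p] as first coordinate, monotonicity of [cross z p] along a polygon becomes
    monotonicity along the first axis. *)
Definition coords p r z : pt := (cross z p, cross z r).
Definition of_coords p r := linmap R (- r.1) p.1 (- r.2) p.2.

Lemma coordsK p r : cross p r = 1 -> cancel (coords p r) (of_coords p r).
Proof.
move=> pr z; rewrite [RHS]surjective_pairing -[z.1]mulr1 -[z.2]mulr1 -pr.
by rewrite /of_coords /coords /linmap /cross /=; congr pair; ring.
Qed.

Lemma of_coordsK p r : cross p r = 1 -> cancel (of_coords p r) (coords p r).
Proof.
move=> pr z; rewrite [RHS]surjective_pairing -[z.1]mulr1 -[z.2]mulr1 -pr.
by rewrite /of_coords /coords /linmap /cross /=; congr pair; ring.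
Qed.

Lemma area_preserving_of_coords p r :
  cross p r = 1 -> area_preserving R (of_coords p r).
Proof. by move=> pr; apply: area_preserving_linmap; rewrite -pr /cross; ring. Qed.

Lemma cross_coords p r z w :
  cross p r = 1 -> cross (coords p r z) (coords p r w) = cross z w.
Proof. by move=> pr; rewrite -[RHS]mulr1 -pr /coords /cross/=; ring. Qed.

Lemma convex_linmap a b c d K :
  Defs.convex_set K -> Defs.convex_set (linmap R a b c d @^-1` K).
Proof.
move=> cK z w Kz Kw t t01; have := cK _ _ Kz Kw t t01; congr K.
by rewrite /padd/pscale/linmap/=; congr pair; ring.
Qed.

Lemma centrally_symmetric_linmap a b c d K :
  centrally_symmetric K -> centrally_symmetric (linmap R a b c d @^-1` K).
Proof.
move=> sK z /sK; congr K.
by rewrite /popp/linmap/=; congr pair; ring.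
Qed.

Lemma area_ge_decagon K p z0 z1 z2 z3 z4 :
  Defs.convex_set K -> measurable (K : set mpt) -> centrally_symmetric K ->
  K z0 -> K z1 -> K z2 -> K z3 -> K z4 -> p != (0, 0) ->
  [/\ cross z1 p <= cross z0 p, cross z2 p <= cross z1 p,
      cross z3 p <= cross z2 p, cross z4 p <= cross z3 p &
      - cross z0 p <= cross z4 p] ->
  ((decagon z0 z1 z2 z3 z4)%:E <= area K)%E.
Proof.
move=> cK mK sK K0 K1 K2 K3 K4 /exists_dual[r pr] hp.
have [mK' <-] := area_preserving_of_coords _ _ pr _ mK.
have -> : decagon z0 z1 z2 z3 z4 =
    decagon (coords p r z0) (coords p r z1) (coords p r z2) (coords p r z3) (coords p r z4).
  by rewrite /decagon !cross_coords.
apply: area_ge_decagon_x => //=; rewrite ?coordsK//.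
- exact: convex_linmap.
- exact: centrally_symmetric_linmap.
Qed.

End decagon.

(** * Octagons with vertices in any order, deduced from monotone decagons *)

Section octagon.
Variable R : realType.
Local Notation pt := (R^o * R^o)%type.
Implicit Types (z w p q : pt).
Variables (K : set pt) (A : R).
Hypothesis sK : centrally_symmetric R K.
Hypothesis decagonK : forall p z0 z1 z2 z3 z4,
  K z0 -> K z1 -> K z2 -> K z3 -> K z4 -> p != (0, 0) ->
  [/\ cross z1 p <= cross z0 p, cross z2 p <= cross z1 p,
      cross z3 p <= cross z2 p, cross z4 p <= cross z3 p &
      - cross z0 p <= cross z4 p] ->
  decagon R z0 z1 z2 z3 z4 <= A.

(** The degenerate decagon [z w w w w] has value [2 * cross z w], and [cross _ w] is monotone along
    it if [cross z w] is positive. Otherwise a constant decagon gives [0 <= A], which is enough. *)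
Lemma parallelogram_le z w : K z -> K w -> 2 * cross z w <= A.
Proof.
move=> Kz Kw.
have A0 : 0 <= A.
  pose r : pt := if w == (0, 0) then (1, 0) else w.
  have r0 : r != (0, 0).
    by rewrite /r; case: ifPn => // _; apply/eqP => -[] /eqP; rewrite oner_eq0.
  have wr : cross w r = 0.
    by rewrite /r; case: eqVneq => [->|_]; rewrite /cross /=; ring.
  have ww : cross w w = 0 by rewrite /cross; ring.
  have := @decagonK r w w w w w Kw Kw Kw Kw Kw r0.
  by rewrite /decagon wr ww !addr0 oppr0; apply; split.
have [zw|zw] := lerP (cross z w) 0; first by lra.
have w0 : w != (0, 0) by apply: contraTneq zw => ->; rewrite /cross/= !mulr0; lra.
have := @decagonK w z w w w w Kz Kw Kw Kw Kw w0; rewrite /decagon.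
have -> : cross w w = 0 by rewrite /cross; ring.
by move=> h; apply: (le_trans _ (h _)); [|split]; lra.
Qed.

Let ler_rect (S T x y : R) : 0 <= x -> x <= S -> y <= T -> 0 <= T -> x * y <= S * T.
Proof.
move=> x0 xS yT T0; apply: le_trans (_ : x * T <= _).
  exact: ler_wpM2l.
exact: ler_wpM2r.
Qed.

(* In the coordinates s = z x p, t = z x q the points a, b, -a, -b become the
   vertices (k,k), (-k,k), ... of a square. *)
Lemma octagon_le_extremal z0 a z2 b :
  K z0 -> K a -> K z2 -> K b -> 0 < cross a b ->
  let p := padd a b in let q := psub b a in
  cross a b <= cross z0 p -> `|cross z2 p| <= cross z0 p ->
  cross a b <= cross z2 q -> `|cross z0 q| <= cross z2 q ->
  octagon R z0 a z2 b <= A.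
Proof.
move=> K0 Ka K2 Kb k0 p q; set k := cross a b => Sk; rewrite ler_norml => /andP[xS Sx].
move=> Tk; rewrite ler_norml => /andP[yT Ty].
have pq w v : 2 * k * cross w v = cross w p * cross v q - cross w q * cross v p.
  by rewrite /k /p /q /cross /padd /psub/=; ring.
have ap : cross a p = k by rewrite /k /p /cross /padd/=; ring.
have bp : cross b p = - k by rewrite /k /p /cross /padd/=; ring.
have p0 : p != (0, 0).
  by apply: contraTneq k0 => e; rewrite -/k -ap e /cross/= !mulr0; lra.
have k2 : 0 < 2 * k by rewrite mulr_gt0.
have bb : cross b b = 0 by rewrite /cross; ring.
have z22 : cross z2 z2 = 0 by rewrite /cross; ring.
rewrite /octagon; have [xk|kx] := lerP (cross z2 p) k.
  have [kx|xk'] := lerP (- k) (cross z2 p).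
    have := @decagonK p z0 a z2 b b K0 Ka K2 Kb Kb p0; rewrite /decagon bb addr0.
    by apply; rewrite ap bp; split => //; lra.
  (* Now [z2] lies beyond [b], and [b] is dropped. The hexagon exceeds the octagon by the cross
     product of [z0 + b] and [z2 - b], which is nonnegative since [z0] and [z2] are extremal. *)
  have := @decagonK p z0 a z2 z2 z2 K0 Ka K2 K2 K2 p0; rewrite /decagon z22.
  move=> h; apply: (le_trans _ (h _)); last by rewrite ap; split; lra.
  have := pq (padd z0 b) (psub z2 b).
  have -> : cross (padd z0 b) p = cross z0 p - k.
    by rewrite /k /p /cross /padd/=; ring.
  have -> : cross (psub z2 b) q = cross z2 q - k.
    by rewrite /k /q /cross /psub/=; ring.
  have -> : cross (padd z0 b) q = cross z0 q + k.
    by rewrite /k /q /cross /padd/psub/=; ring.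
  have -> : cross (psub z2 b) p = cross z2 p + k.
    by rewrite /k /p /cross /padd/psub/=; ring.
  have -> : cross (padd z0 b) (psub z2 b) = cross z0 z2 - cross z0 b - cross z2 b.
    by rewrite /cross /padd/psub/=; ring.
  move=> W; have : - (cross z2 p + k) * - (cross z0 q + k) <=
      (cross z0 p - k) * (cross z2 q - k) by apply: ler_rect; lra.
  rewrite mulrNN => W2.
  have : 0 <= 2 * k * (cross z0 z2 - cross z0 b - cross z2 b) by rewrite W; lra.
  rewrite (pmulr_rge0 _ k2) => W3; clear -W3; lra.
(* Now [z2] comes before [a], and [a] is dropped; the gain is the cross product of [z0 - a] and
   [z2 - a]. *)
have := @decagonK p z0 z2 b b b K0 K2 Kb Kb Kb p0; rewrite /decagon bb.
move=> h; apply: (le_trans _ (h _)); last by rewrite bp; split; lra.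
have := pq (psub z0 a) (psub z2 a).
have -> : cross (psub z0 a) p = cross z0 p - k.
  by rewrite /k /p /cross /padd/psub/=; ring.
have -> : cross (psub z2 a) q = cross z2 q - k.
  by rewrite /k /q /cross /psub/=; ring.
have -> : cross (psub z0 a) q = cross z0 q - k.
  by rewrite /k /q /cross /padd/psub/=; ring.
have -> : cross (psub z2 a) p = cross z2 p - k.
  by rewrite /k /p /cross /padd/psub/=; ring.
have -> : cross (psub z0 a) (psub z2 a) = cross z0 z2 - cross z0 a - cross a z2.
  by rewrite /cross /padd/psub/=; ring.
move=> W; have : (cross z2 p - k) * (cross z0 q - k) <=
    (cross z0 p - k) * (cross z2 q - k) by apply: ler_rect; lra.
move=> W2.
have : 0 <= 2 * k * (cross z0 z2 - cross z0 a - cross a z2) by rewrite W; lra.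
rewrite (pmulr_rge0 _ k2) => W3; clear -W3; lra.
Qed.

(** The point [z] is chosen among [a], [z0], [z2] and the opposites of the last two so as to
    maximize [cross z p]. The last clause records that any common bound in the direction [q]
    survives this choice. *)
Lemma exists_extremal z0 z2 a p q (k : R) : K z0 -> K z2 -> K a ->
  cross a p = k -> `|cross a q| <= k ->
  exists z, [/\ K z, k <= cross z p, `|cross z0 p| <= cross z p,
    `|cross z2 p| <= cross z p &
    forall T, k <= T -> `|cross z0 q| <= T -> `|cross z2 q| <= T -> `|cross z q| <= T].
Proof.
move=> K0 K2 Ka ap aq.
have oppE z r : cross (popp R z) r = - cross z r by rewrite /cross/popp/=; ring.
have sgn z : K z -> exists w, [/\ K w, cross w p = `|cross z p| &
    `|cross w q| = `|cross z q|].
  move=> Kz; have [zp|/ltW zp] := lerP 0 (cross z p).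
    by exists z; rewrite ger0_norm.
  by exists (popp R z); split; [exact: sK|rewrite ler0_norm|rewrite oppE normrN].
have [w0 [Kw0 w0p w0q]] := sgn _ K0; have [w2 [Kw2 w2p w2q]] := sgn _ K2.
have [h|h] := lerP `|cross z0 p| `|cross z2 p|.
  have [h2|h2] := lerP `|cross z2 p| k.
    by exists a; rewrite ap; split => //; [exact: le_trans h2|move=> T /(le_trans aq)].
  by exists w2; rewrite w2p; split => //; [exact: ltW|move=> T _ _; rewrite w2q].
have [h2|h2] := lerP `|cross z0 p| k.
  exists a; rewrite ap; split => //; last by move=> T /(le_trans aq).
  exact: le_trans (ltW h) h2.
by exists w0; rewrite w0p; split => //; [exact: ltW|exact: ltW|move=> T _ + _; rewrite w0q].
Qed.

(** The octagon equals [cross z0 p + cross z2 q] with [p = a + b] and [q = b - a]. Hence moving [z0]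
    and [z2] to extremal points for [p] and [q] can only increase it. *)
Lemma octagon_le_pos z0 a z2 b :
  K z0 -> K a -> K z2 -> K b -> 0 < cross a b -> octagon R z0 a z2 b <= A.
Proof.
move=> K0 Ka K2 Kb k0; pose p := padd a b; pose q := psub b a.
have ap : cross a p = cross a b by rewrite /p /cross /padd/=; ring.
have aq : cross a q = cross a b by rewrite /q /cross /psub/=; ring.
have bq : cross b q = cross a b by rewrite /q /cross /psub/=; ring.
have bp : cross b p = - cross a b by rewrite /p /cross /padd/=; ring.
have nk : `|cross a b| = cross a b by rewrite gtr0_norm.
have [|z [Kz z1 z2' z3 z4]] := exists_extremal z0 z2 a p q _ K0 K2 Ka ap.
  by rewrite aq nk.
have [|w [Kw w1 w2 w3 w4]] := exists_extremal z0 z2 b q p _ K0 K2 Kb bq.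
  by rewrite bp normrN nk.
have := octagon_le_extremal z a w b Kz Ka Kw Kb k0 z1 (w4 _ z1 z2' z3) w1 (z4 _ w1 w2 w3).
apply: le_trans.
have e v u : octagon R v a u b = cross v p + cross u q.
  by rewrite /octagon /cross /p /q /padd /psub/=; ring.
rewrite !e; apply: lerD; [exact: le_trans (ler_norm _) z2'|exact: le_trans (ler_norm _) w3].
Qed.

(** Exchanging [z1] and [z3] reverses the sign of [cross z1 z3], which reduces the negative case to
    the positive one. *)
Lemma octagon_swap z0 z1 z2 z3 :
  octagon R z0 z1 z2 z3 = octagon R z0 z3 (popp R z2) z1.
Proof. by rewrite /octagon/cross/popp/=; ring. Qed.

(** Here [b] is [l] times [a] with [l] between -1 and 1, so the octagon is a convex combination,
    with weights [(1 + l) / 2] and [(1 - l) / 2], of two parallelograms. If [a] vanishes, so does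
    the octagon. *)
Lemma octagon_le_parallel z0 a z2 b :
  K z0 -> K a -> K z2 -> cross a b = 0 ->
  b.1 ^+ 2 + b.2 ^+ 2 <= a.1 ^+ 2 + a.2 ^+ 2 -> octagon R z0 a z2 b <= A.
Proof.
move=> K0 Ka K2 ab ba.
have h0 := parallelogram_le _ _ K0 Ka.
have h2 := parallelogram_le _ _ (sK _ K2) Ka.
have h3 := parallelogram_le _ _ Ka Ka.
have [n0|n0] := eqVneq (a.1 ^+ 2 + a.2 ^+ 2) 0.
  have a1 : a.1 = 0 by nra.
  have a2 : a.2 = 0 by nra.
  have b1 : b.1 = 0 by nra.
  have b2 : b.2 = 0 by nra.
  by move: h3; rewrite /octagon/cross a1 a2 b1 b2; lra.
have ngt : 0 < a.1 ^+ 2 + a.2 ^+ 2 by rewrite lt_neqAle eq_sym n0; nra.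
pose l := (a.1 * b.1 + a.2 * b.2) / (a.1 ^+ 2 + a.2 ^+ 2).
have abe : a.1 * b.2 = a.2 * b.1 by move: ab; rewrite /cross; lra.
have b1 : b.1 = l * a.1.
  by apply: (mulIf n0); rewrite /l mulrAC divfK//; ring: abe.
have b2 : b.2 = l * a.2.
  by apply: (mulIf n0); rewrite /l mulrAC divfK//; ring: abe.
have l1 : l ^+ 2 <= 1.
  rewrite -(ler_pM2r ngt) mul1r; apply: le_trans ba; rewrite b1 b2; lra.
have [l2 l3] : -1 <= l /\ l <= 1 by split; nra.
have -> : octagon R z0 a z2 b = (1 + l) * cross z0 a + (1 - l) * cross (popp R z2) a.
  by rewrite /octagon/cross/popp/= b1 b2; ring.
nra.
Qed.

(* Unlike for decagons, the order of the vertices is irrelevant. *)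
Lemma octagon_le z0 z1 z2 z3 :
  K z0 -> K z1 -> K z2 -> K z3 -> octagon R z0 z1 z2 z3 <= A.
Proof.
move=> K0 K1 K2 K3; have K2' := sK _ K2.
have [h|h|h] := ltgtP (cross z1 z3) 0.
- rewrite octagon_swap; apply: octagon_le_pos => //.
  by move: h; rewrite /cross; lra.
- exact: octagon_le_pos.
have h' : cross z3 z1 = 0 by move: h; rewrite /cross; lra.
have [n|/ltW n] := lerP (z3.1 ^+ 2 + z3.2 ^+ 2) (z1.1 ^+ 2 + z1.2 ^+ 2).
  exact: octagon_le_parallel.
by rewrite octagon_swap; apply: octagon_le_parallel.
Qed.

End octagon.

(** * Positions of the four triangles *)

Section casework.
Variable R : realType.
Local Notation pt := (R^o * R^o)%type.
Implicit Types (z w : pt) (K : set pt).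

Local Notation neg := (popp R).

(* In the frame (E1, E2), X and Y are (1/2 + u, 1/2 + p) and (-1/2 - v, 1/2 + q);
   t, s, b, d stand for a/c, d/b, b/c, d/a. The unit square is the case
   u = p = v = q = 0. *)
Record config (K : set pt) (A t s b d u p v q : R) : Prop := Config {
  config_sym : centrally_symmetric R K;
  config_oct : forall z0 z1 z2 z3, K z0 -> K z1 -> K z2 -> K z3 ->
    octagon R z0 z1 z2 z3 <= A;
  config_dec : forall z0 z1 z2 z3 z4,
    K z0 -> K z1 -> K z2 -> K z3 -> K z4 ->
    [/\ z0.2 <= z1.2, z1.2 <= z2.2, z2.2 <= z3.2, z3.2 <= z4.2 & z4.2 <= - z0.2] ->
    decagon R z0 z1 z2 z3 z4 <= A;
  config_X : K (1/2 + u, 1/2 + p);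
  config_X1 : K (1/2 + u - 1, 1/2 + p - t);
  config_X2 : K (1/2 + u - s, 1/2 + p - 1);
  config_Y : K (- (1/2) - v, 1/2 + q);
  config_Y1 : K (- (1/2) - v + 1, 1/2 + q - b);
  config_Y2 : K (- (1/2) - v + d, 1/2 + q - 1);
}.

(** Reflection in the second axis exchanges the roles of [X] and [Y], so each of the asymmetric
    cases below needs to be treated only once. *)
Lemma config_mirror K A t s b d u p v q : config K A t s b d u p v q ->
  config [set z | K (- z.1, z.2)] A b d t s v q u p.
Proof.
case=> sK oK dK X X1 X2 Y Y1 Y2; split => /=.
- by move=> z /sK; rewrite /popp/=.
- move=> z0 z1 z2 z3 K0 K1 K2 K3; apply: le_trans (oK _ _ _ _ K3 K2 K1 K0).
  by rewrite le_eqVlt; apply/orP; left; apply/eqP; rewrite /octagon/cross/=; ring.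
- move=> z0 z1 z2 z3 z4 K0 K1 K2 K3 K4 [/= h0 h1 h2 h3 h4].
  (* The reflection reverses orientation, so the closed polygon is traversed backwards from [z0]. *)
  apply: le_trans (dK _ _ _ _ _ K0 (sK _ K4) (sK _ K3) (sK _ K2) (sK _ K1) _).
    by rewrite le_eqVlt; apply/orP; left; apply/eqP; rewrite /decagon/cross/=; ring.
  by split=> /=; lra.
- by move: Y; congr K; congr pair; field.
- by move: Y1; congr K; congr pair; field.
- by move: Y2; congr K; congr pair; field.
- by move: X; congr K; congr pair; field.
- by move: X1; congr K; congr pair; field.
- by move: X2; congr K; congr pair; field.
Qed.

(** * Polygons of area at least 1, by the position of [X] and [Y] *)

Section bounds.
Variables (K : set pt) (A t s b d u p v q : R).
Hypothesis cK : config K A t s b d u p v q.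
Hypotheses (t0 : 0 <= t) (t1 : t <= 1) (s0 : 0 <= s) (s1 : s <= 1).
Hypotheses (b0 : 0 <= b) (b1 : b <= 1) (d0 : 0 <= d) (d1 : d <= 1).
Hypothesis bt1 : 1 <= b + t.

Let X : pt := (1/2 + u, 1/2 + p).
Let X1 : pt := (1/2 + u - 1, 1/2 + p - t).
Let X2 : pt := (1/2 + u - s, 1/2 + p - 1).
Let Y : pt := (- (1/2) - v, 1/2 + q).
Let Y1 : pt := (- (1/2) - v + 1, 1/2 + q - b).
Let Y2 : pt := (- (1/2) - v + d, 1/2 + q - 1).

Let KX : K X := config_X _ _ _ _ _ _ _ _ _ _ cK.
Let KX1 : K X1 := config_X1 _ _ _ _ _ _ _ _ _ _ cK.
Let KX2 : K X2 := config_X2 _ _ _ _ _ _ _ _ _ _ cK.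
Let KY : K Y := config_Y _ _ _ _ _ _ _ _ _ _ cK.
Let KY1 : K Y1 := config_Y1 _ _ _ _ _ _ _ _ _ _ cK.
Let KY2 : K Y2 := config_Y2 _ _ _ _ _ _ _ _ _ _ cK.
Let sK : centrally_symmetric R K := config_sym _ _ _ _ _ _ _ _ _ _ cK.
Let oK := config_oct _ _ _ _ _ _ _ _ _ _ cK.
Let dK := config_dec _ _ _ _ _ _ _ _ _ _ cK.

Ltac oct z0 z1 z2 z3 :=
  have : octagon R z0 z1 z2 z3 <= A by apply: oK => //; exact: sK.
Ltac hyps := move: (t0) (t1) (s0) (s1) (b0) (b1) (d0) (d1) (bt1) => ? ? ? ? ? ? ? ? ?.
Ltac expand := rewrite /octagon/decagon/cross/popp /X/X1/X2/Y/Y1/Y2/=.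

(** The two octagons are hexagons of values [1 + (u + v) + d * (p - q)] and
    [1 + (u + v) + s * (q - p)], and one of the last terms is nonnegative. *)
Lemma top_bound : 0 <= u + v -> 1 <= A.
Proof.
hyps; move=> uv; have [pq|pq] := lerP q p.
  have : 0 <= d * (p - q) by apply: mulr_ge0; lra.
  by oct X (neg Y2) Y Y; expand; lra.
have : 0 <= s * (q - p) by apply: mulr_ge0; lra.
by oct X (neg X2) Y Y; expand; lra.
Qed.

(** As before, with the values [1 + (p + q) + b * (u - v)] and [1 + (p + q) + t * (v - u)]. *)
Lemma side_bound : 0 <= p + q -> 1 <= A.
Proof.
hyps; move=> pq; have [uv|uv] := lerP v u.
  have : 0 <= b * (u - v) by apply: mulr_ge0; lra.
  by oct (neg Y) Y1 X X; expand; lra.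
have : 0 <= t * (v - u) by apply: mulr_ge0; lra.
by oct (neg Y) (neg X1) X X; expand; lra.
Qed.

(** The last two hypotheses place [neg Y] not above [Y1] and [neg X1] not above [X], which makes the
    decagons monotone in height. For [q <= p] the value is
    [1 + d * (p - q) - (b + t - 1) * (u + v)]; otherwise [s * (q - p)] replaces the middle term. *)
Lemma monotone_bound : u + v <= 0 -> p + q <= 0 ->
  - (1 - b) <= 2 * q -> - (1 - t) <= 2 * p -> 1 <= A.
Proof.
hyps; move=> uv pq qb pt; have [hpq|hpq] := lerP q p.
  have : decagon R Y2 (neg Y) Y1 (neg X1) X <= A.
    apply: dK => //; try exact: sK.
    by expand; split; lra.
  have : 0 <= d * (p - q) by apply: mulr_ge0; lra.
  have : 0 <= (b + t - 1) * - (u + v) by apply: mulr_ge0; lra.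
  by expand; lra.
have : 0 <= s * (q - p) by apply: mulr_ge0; lra.
have : 0 <= (b + t - 1) * - (u + v) by apply: mulr_ge0; lra.
have : decagon R X2 (neg Y) Y1 (neg X1) X <= A.
  apply: dK => //; try exact: sK.
  by expand; split; lra.
by expand; lra.
Qed.

(** Now [X] is not above [neg X1], so it is left out of the polygons used in [monotone_bound]; the
    remaining four vertices give an octagon, for which no monotonicity is required. *)
Lemma low_bound : u <= 0 -> v <= 0 -> 2 * p <= - (1 - t) -> 1 <= A.
Proof.
hyps; move=> u0 v0 pt.
have hv : 0 <= (- v) * (b + t - 1) by apply: mulr_ge0; lra.
have [hpq|hpq] := lerP q p.
  have h1 : 0 <= (- u) * (b - 2 * q) by apply: mulr_ge0; lra.
  have h2 : 0 <= (- v) * (- (2 * p) - (1 - t)) by apply: mulr_ge0; lra.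
  have h3 : 0 <= d * (- (p + q) - (1 - t)) by apply: mulr_ge0; lra.
  by oct Y2 (neg Y) Y1 (neg X1); expand; lra.
have h1 : 0 <= (- u) * (1 + b - t) by apply: mulr_ge0; lra.
have h2 : 0 <= s * (q - p) by apply: mulr_ge0; lra.
have h3 : 0 <= (1 - s) * (- (1 - t) - 2 * p) by apply: mulr_ge0; lra.
by oct X2 (neg Y) Y1 (neg X1); expand; lra.
Qed.

(** No single polygon is used here: assuming [A < 1], octagons around [X] and [Y] force the
    quadratic term [G] to be large and [p] to be low, and then one further octagon is too large. *)
Lemma skew_bound : (b <= t -> d <= s) -> 0 <= u -> v <= 0 -> u + v <= 0 ->
  p + q <= 0 -> 1 <= A.
Proof.
hyps; move=> bt_ds u0 v0 uv pq; rewrite leNgt; apply/negP => A1.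
(* [G] is the quadratic part of [cross X Y]; the next two octagons have values
   [1 + b * (u - v) + s * (q - p) - 2 * G] and [1 + b * (u - v) + d * (p - q) - 2 * G]. *)
pose G := u * q + p * v.
have hs : b * (u - v) + s * (q - p) < 2 * G.
  by oct (neg X) X2 (neg Y) Y1; rewrite /G; expand; lra.
have hd : b * (u - v) + d * (p - q) < 2 * G.
  by oct (neg X) Y2 (neg Y) Y1; rewrite /G; expand; lra.
have G0 : b * (u - v) < 2 * G.
  have [pq'|pq'] := lerP q p.
    have : 0 <= d * (p - q) by apply: mulr_ge0; lra.
    lra.
  have : 0 <= s * (q - p) by apply: mulr_ge0; lra.
  lra.
(* Since [2 * G = 2 * u * (p + q) - 2 * p * (u - v)] and the first summand is at most 0, the reverse
   inequality would contradict [G0]. *)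
have pb : b < - (2 * p).
  rewrite ltNge; apply/negP => pb.
  have h1 : 0 <= u * (- (p + q)) by apply: mulr_ge0; lra.
  have h2 : 0 <= (b + 2 * p) * (u - v) by apply: mulr_ge0; lra.
  move: G0; rewrite /G; lra.
have [tb|bt] := lerP t b.
  have h1 : 0 <= s * (b - t) by apply: mulr_ge0; lra.
  have h2 : 0 <= (b + t) * (- v - u) by apply: mulr_ge0; lra.
  have h3 : 0 <= t * u by apply: mulr_ge0.
  oct X1 X2 X2 Y1; move: hs; rewrite /G; expand; lra.
have h1 : 0 <= (b + t - 1) * (- v) by apply: mulr_ge0; lra.
have h2 : 0 <= d * (- (2 * p) - b) by apply: mulr_ge0; lra.
have h3 : 0 <= d * (b + t - 1) by apply: mulr_ge0; lra.
have [hpq|hpq] := lerP q p.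
  have h4 : 0 <= d * (p - q) by apply: mulr_ge0; lra.
  oct Y2 (neg Y) Y1 (neg X1); move: hd; rewrite /G; expand; lra.
(* As [b < t], one has [d <= s], so [hs] remains true with [d] in place of [s]. *)
have h4 : 0 <= (s - d) * (q - p).
  by apply: mulr_ge0; rewrite subr_ge0; [exact/bt_ds/ltW|exact: ltW].
oct Y2 (neg Y) Y1 (neg X1); move: hs; rewrite /G; expand; lra.
Qed.

End bounds.

Lemma config_bound K A t s b d u p v q : config K A t s b d u p v q ->
  0 <= t -> t <= 1 -> 0 <= s -> s <= 1 -> 0 <= b -> b <= 1 ->
  0 <= d -> d <= 1 -> 1 <= b + t ->
  (b <= t -> d <= s) -> (t <= b -> s <= d) -> 1 <= A.
Proof.
move=> cK t0 t1 s0 s1 b0 b1 d0 d1 bt1 bt_ds tb_sd.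
have cM := config_mirror _ _ _ _ _ _ _ _ _ _ cK.
have tb1 : 1 <= t + b by lra.
have [uv|/ltW uv] := lerP 0 (u + v).
  exact: (top_bound _ _ _ _ _ _ _ _ _ _ cK).
have [pq|/ltW pq] := lerP 0 (p + q).
  exact: (side_bound _ _ _ _ _ _ _ _ _ _ cK).
have [u0|/ltW u0] := lerP 0 u.
  by apply: (skew_bound _ _ _ _ _ _ _ _ _ _ cK) => //; lra.
have [v0|/ltW v0] := lerP 0 v.
  by apply: (skew_bound _ _ _ _ _ _ _ _ _ _ cM) => //; lra.
have [tp|/ltW tp] := lerP (- (1 - t)) (2 * p); last first.
  exact: (low_bound _ _ _ _ _ _ _ _ _ _ cK).
have [bq|/ltW bq] := lerP (- (1 - b)) (2 * q); last first.
  exact: (low_bound _ _ _ _ _ _ _ _ _ _ cM).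
exact: (monotone_bound _ _ _ _ _ _ _ _ _ _ cK).
Qed.

End casework.

(** * Symmetrization *)

Section symmetrization.
Variable R : realType.
Local Notation pt := (R^o * R^o)%type.
Local Notation mR := (measurableTypeR R).
Local Notation mpt := (mR * mR)%type.
Local Notation mu := (@lebesgue_measure R).
Implicit Types (K : set pt) (z w d : pt).

Lemma ge0_integral_reflect (k : R) (g : R -> \bar R) :
  measurable_fun setT (g : mR -> \bar R) -> (forall x, 0 <= g x)%E ->
  (\int[mu]_x g (k - x)%R = \int[mu]_x g x)%E.
Proof.
move=> mg g0; rewrite -(ge0_integral_shift R k g)//.
have mk : measurable_fun setT (fun x : mR => x + k : mR) by exact: measurable_funD.
have mgk : measurable_fun setT ((fun x => g (x + k)) : mR -> \bar R).
  by apply: (@measurableT_comp _ _ _ mR mR _ g).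
transitivity (\int[pushforward mu (-%R : mR -> mR)]_x g (x + k)%R)%E; last first.
  by apply: eq_measure_integral => A mA _; exact: lebesgue_measureN.
have mo : measurable_fun setT (-%R : mR -> mR) by exact: measurable_funN.
rewrite ge0_integral_pushforward//.
by apply: eq_integral => x _ /=; rewrite addrC.
Qed.

(** [P] and [Q] are bounded intervals, and their half-differences lie in an interval whose length is
    the mean of theirs. Passing to a measurable subset [S] avoids measurability of the set of all
    half-differences. *)
Lemma lebesgue_measure_half_diff (P Q : set R) (B : R) :
  measurable (P : set mR) -> measurable (Q : set mR) ->
  (forall x y r, P x -> P y -> x < r < y -> P r) ->
  (forall x y r, Q x -> Q y -> x < r < y -> Q r) ->
  (forall x, P x -> `|x| <= B) -> (forall x, Q x -> `|x| <= B) ->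
  forall S : set R, measurable (S : set mR) ->
  S `<=` [set r | exists x y, [/\ P x, Q y & r = (x - y) / 2]] ->
  (2%:E * mu S <= mu P + mu Q)%E.
Proof.
move=> mP mQ cP cQ bP bQ S mS SPQ.
have [[s Ss]|] := pselect (S !=set0); last first.
  by move=> /set0P/negP/negPn/eqP->; rewrite measure0 mule0 adde_ge0.
have [x0 [y0 [Px0 Qy0 _]]] := SPQ _ Ss.
(* The open interval between [inf I] and [sup I] lies in [I], whatever happens at the endpoints. *)
have hull (I : set R) i0 : measurable (I : set mR) -> I i0 ->
    (forall x y r, I x -> I y -> x < r < y -> I r) ->
    (forall x, I x -> `|x| <= B) -> exists a b, [/\ a <= b,
      forall x, I x -> a <= x <= b & ((b - a)%:E <= mu I)%E].
  move=> mI Ii0 cI bI.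
  have hs : has_sup I.
    by split; [exists i0|exists B => x /bI; rewrite ler_norml => /andP[]].
  have hi : has_inf I.
    by split; [exists i0|exists (- B) => x /bI; rewrite ler_norml => /andP[]].
  have infI x : I x -> inf I <= x by move=> Ix; apply: ge_inf => //; exact: hi.2.
  have supI x : I x -> x <= sup I by move=> Ix; apply: ub_le_sup => //; exact: hs.2.
  exists (inf I), (sup I); split.
  - exact: le_trans (infI _ Ii0) (supI _ Ii0).
  - by move=> x Ix; rewrite infI ?supI.
  - have -> : (sup I - inf I)%:E = mu `]inf I, sup I[%classic.
      rewrite lebesgue_measure_itv/= lte_fin; case: ltP => // h.
      have := infI _ Ii0; have := supI _ Ii0.
      by move=> h1 h2; congr EFin; lra.
    apply: le_measure; rewrite ?inE// => r /=; rewrite in_itv/= => /andP[ir rs].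
    have [x Ix xr] := inf_lt (ex_intro _ i0 Ii0) ir.
    have [y Iy ry] := sup_gt (ex_intro _ i0 Ii0) rs.
    by apply: (cI x y) => //; rewrite xr.
have [a1 [b1 [ab1 P1 muP]]] := hull P x0 mP Px0 cP bP.
have [a2 [b2 [ab2 Q2 muQ]]] := hull Q y0 mQ Qy0 cQ bQ.
pose J := `[(a1 - b2) / 2, (b1 - a2) / 2]%classic : set R.
apply: (@le_trans _ _ (2%:E * mu J)%E).
  rewrite lee_pmul2l ?lte_fin//; apply: le_measure; rewrite ?inE//; first exact: measurable_itv.
  move=> r Sr; have [x [y [/P1/andP[h1 h2] /Q2/andP[h3 h4] ->]]] := SPQ _ Sr.
  move=> /=.
  by rewrite in_itv/=; apply/andP; split; lra.
apply: le_trans (leeD muP muQ).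
rewrite lebesgue_measure_itv/= lte_fin; case: ltP => h.
  by rewrite -!EFinD -EFinM lee_fin; lra.
by rewrite mule0 -EFinD lee_fin; lra.
Qed.

(** The section of [S] at [x] consists of half-differences of points from the sections of [K] at
    [m + x] and [m - x]. Integrated over [x], the measures of these two sections each give the area
    of [K]. *)
Lemma area_half_diff_x K (S : set pt) (m B : R) :
  Defs.convex_set K -> measurable (K : set mpt) -> (forall z, K z -> `|z.2| <= B) ->
  measurable (S : set mpt) ->
  S `<=` [set z | exists z1 z2, [/\ K z1, K z2, z1.1 + z2.1 = 2 * m &
    z = pscale 2^-1 (psub z1 z2)]] ->
  (area S <= area K)%E.
Proof.
move=> cK mK bK mS SK.
pose g (x : R) := mu (xsection K x).
have mg : measurable_fun setT (g : mR -> \bar R) by exact: measurable_fun_xsection.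
have g0 x : (0 <= g x)%E by exact: measure_ge0.
have mg1 : measurable_fun setT ((fun x => g (x + m)) : mR -> \bar R).
  by apply: (@measurableT_comp _ _ _ mR mR _ g) => //; exact: measurable_funD.
have mg2 : measurable_fun setT ((fun x => g (m - x)) : mR -> \bar R).
  by apply: (@measurableT_comp _ _ _ mR mR _ g) => //; exact: measurable_funB.
have msK x : measurable (xsection K x : set mR) by exact: (@measurable_xsection _ _ mR mR).
have cvx (x : R) (y1 y2 r : R) : xsection K x y1 -> xsection K x y2 -> y1 < r < y2 ->
    xsection K x r.
  rewrite /xsection/= !inE => K1 K2 /andP[r1 r2].
  have := cK _ _ K1 K2 ((r - y1) / (y2 - y1)).
  have -> : padd (pscale (1 - (r - y1) / (y2 - y1)) (x, y1))
      (pscale ((r - y1) / (y2 - y1)) (x, y2)) = (x, r).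
    by rewrite /padd/pscale/=; congr pair; field; rewrite gt_eqF// subr_gt0 (lt_trans r1).
  apply; apply/andP; split; first by apply: divr_ge0; lra.
  by rewrite ler_pdivrMr; lra.
have bd (x y : R) : xsection K x y -> `|y| <= B by rewrite /xsection/= inE => /bK.
rewrite -(@lee_pmul2l _ 2%:E) ?lte_fin//.
have -> : (2%:E * area K = \int[mu]_x (g (x + m)%R + g (m - x)%R))%E.
  rewrite ge0_integralD// ge0_integral_shift// ge0_integral_reflect//.
  by rewrite -[2]/(1 + 1) EFinD ge0_muleDl ?lee_fin// !mul1e.
rewrite /area /product_measure1 -ge0_integralZl//; last exact: measurable_fun_xsection.
apply: ge0_le_integral => //.
- by move=> x ?; apply: mule_ge0; rewrite ?lee_fin.
- by apply: measurable_funeM; exact: measurable_fun_xsection.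
- exact: emeasurable_funD.
move=> x ?; apply: (lebesgue_measure_half_diff _ _ B) => //.
- exact: cvx.
- exact: cvx.
- exact: bd.
- exact: bd.
- exact: (@measurable_xsection _ _ mR mR).
move=> y; rewrite /xsection/= inE => /SK[z1 [z2 [K1 K2 lev [e1 e2]]]].
exists z1.2, z2.2; split; rewrite ?inE.
- by rewrite (_ : (x + m, z1.2) = z1)// [RHS]surjective_pairing; congr pair; lra.
- by rewrite (_ : (m - x, z2.2) = z2)// [RHS]surjective_pairing; congr pair; lra.
- by rewrite e2 mulrC.
Qed.


Lemma continuous_cross d : continuous (cross d : pt -> R^o).
Proof.
move=> z; apply: cvgB; apply: cvgM; try exact: cvg_cst.
  exact: cvg_snd.
exact: cvg_fst.
Qed.

Lemma continuous_pair (T : topologicalType) (f g : T -> R^o) :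
  continuous f -> continuous g -> continuous (fun x => (f x, g x) : pt).
Proof. by move=> cf cg x; apply: (cvg_pair (cf x) (cg x)). Qed.

Lemma continuous_half_diff :
  continuous (fun zw : pt * pt => pscale 2^-1 (psub zw.1 zw.2)).
Proof.
apply: continuous_pair => zw; apply: cvgM; try exact: cvg_cst; apply: cvgB.
- by apply: (cvg_comp _ _ cvg_fst); exact: cvg_fst.
- by apply: (cvg_comp _ _ cvg_snd); exact: cvg_fst.
- by apply: (cvg_comp _ _ cvg_fst); exact: cvg_snd.
- by apply: (cvg_comp _ _ cvg_snd); exact: cvg_snd.
Qed.

(* Intersecting K with the lines parallel to d and replacing the section at
   height l/2 + y by half the difference of the sections at heights l/2 + y and
   l/2 - y does not increase the area. *)
Definition half_diff d (l : R) K : set pt :=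
  (fun zw : pt * pt => pscale 2^-1 (psub zw.1 zw.2)) @`
    ((K `*` K) `&` [set zw | cross d zw.1 + cross d zw.2 = l]).

Lemma compact_half_diff d l K : compact K -> compact (half_diff d l K).
Proof.
move=> cK; apply: continuous_compact.
  exact/continuous_subspaceT/continuous_half_diff.
apply: compact_closedI; first exact: compact_setX.
have -> : [set zw : pt * pt | cross d zw.1 + cross d zw.2 = l] =
    (fun zw : pt * pt => cross d zw.1 + cross d zw.2 : R^o) @^-1` [set l] by [].
apply: closed_comp; last exact: closed_eq.
move=> zw _; apply: cvgD.
  by apply: cvg_comp; [exact: cvg_fst|exact: continuous_cross].
by apply: cvg_comp; [exact: cvg_snd|exact: continuous_cross].
Qed.

Lemma compact_coord_bounded K : compact K ->
  exists B, forall z, K z -> `|z.1| <= B /\ `|z.2| <= B.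
Proof.
move=> /compact_bounded[B [_ hB]]; exists (B + 1) => z Kz.
have : `|z| <= B + 1 := hB (B + 1) (ltr_pwDr ltr01 (lexx B)) z Kz.
by rewrite prod_normE ge_max => /andP[].
Qed.

Lemma compact_measurable_plane K : compact K -> measurable (K : set mpt).
Proof.
move=> cK; apply: closed_measurable_plane; apply: compact_closed cK.
exact: (@norm_hausdorff _ pt).
Qed.

Lemma area_half_diff d l K : d != (0, 0) -> Defs.convex_set K -> compact K ->
  (area (half_diff d l K) <= area K)%E.
Proof.
move=> /exists_dual[r dr] cvK cK.
have [mS <-] := area_preserving_of_coords _ _ _ dr _
  (compact_measurable_plane _ (compact_half_diff d l _ cK)).
have [mK <-] := area_preserving_of_coords _ _ _ dr _ (compact_measurable_plane _ cK).
have [B hB] := compact_coord_bounded _ cK.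
(* The first coordinate [cross z d] is the negative of [cross d z], so the two levels add up to
   [- l]. *)
apply: (@area_half_diff_x _ _ (- l / 2) (B * (`|r.1| + `|r.2|))) => //.
- exact: convex_linmap.
- move=> z /hB[h1 h2]; rewrite -[z](of_coordsK _ _ _ dr) /=.
  rewrite /cross mulrDr; apply: le_trans (ler_normB _ _) _.
  by rewrite !normrM addrC lerD// ler_wpM2r.
move=> z [[z1 z2] [[/= K1 K2] lev] e].
exists (coords R d r z1), (coords R d r z2); split.
- by rewrite /= coordsK.
- by rewrite /= coordsK.
- by rewrite -lev /coords /cross/=; field.
- rewrite -[z](of_coordsK _ _ _ dr) -e.
  by rewrite /coords /cross /pscale /psub/=; congr pair; ring.
Qed.

(** With [d] along [s2 - s1], the sums [s1] and [s2] have the same level, so one symmetrization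
    serves both pairs of triangles: matching vertices of a triangle and of its reflected copy have a
    constant sum. *)
Lemma symmetrization K (s1 s2 : pt) : Defs.convex_set K -> compact K ->
  exists S : set pt, [/\ Defs.convex_set S, measurable (S : set mpt),
    centrally_symmetric R S, (area S <= area K)%E &
    forall z w, K z -> K w -> padd z w = s1 \/ padd z w = s2 ->
      S (pscale 2^-1 (psub z w))].
Proof.
move=> cvK cK.
pose d : pt := if psub s2 s1 == (0, 0) then (1, 0) else psub s2 s1.
have d0 : d != (0, 0).
  by rewrite /d; case: ifPn => // _; apply/eqP => -[] /eqP; rewrite oner_eq0.
have ds : cross d s2 = cross d s1.
  rewrite /d; case: ifPn => [/eqP[/eqP e1 /eqP e2]|_].
    by move: e1 e2; rewrite !subr_eq0 => /eqP e1 /eqP e2; rewrite /cross e1 e2.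
  by rewrite /cross/psub/=; ring.
exists (half_diff d (cross d s1) K); split.
- move=> _ _ [[z1 z2] [[/= Kz1 Kz2] lz] <-] [[w1 w2] [[/= Kw1 Kw2] lw] <-] t t01.
  exists (padd (pscale (1 - t) z1) (pscale t w1), padd (pscale (1 - t) z2) (pscale t w2)).
    split; first by split; exact: cvK.
    rewrite /= -[RHS]mul1r -(subrK t 1) mulrDl -{1}lz -lw /cross/padd/pscale/=; ring.
  by rewrite /padd/pscale/psub/=; congr pair; ring.
- by apply: compact_measurable_plane; exact: compact_half_diff.
- move=> _ [[z1 z2] [[/= Kz1 Kz2] lz] <-]; exists (z2, z1).
    by split=> //=; rewrite addrC.
  by rewrite /popp/pscale/psub/=; congr pair; ring.
- exact: area_half_diff.
- move=> z w Kz Kw h; exists (z, w) => //; split => //=.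
  have -> : cross d z + cross d w = cross d (padd z w) by rewrite /cross/padd/=; ring.
  by case: h => ->.
Qed.

End symmetrization.

(** * From four triangles in a convex set to a configuration *)

Section four_triangles.
Variable R : realType.
Local Notation pt := (R^o * R^o)%type.
Local Notation mR := (measurableTypeR R).
Local Notation mpt := (mR * mR)%type.
Implicit Types (K : set pt) (z w : pt).

Lemma config_of_symmetric K t s b d u p v q :
  Defs.convex_set K -> measurable (K : set mpt) -> centrally_symmetric R K ->
  K (1/2 + u, 1/2 + p) -> K (1/2 + u - 1, 1/2 + p - t) ->
  K (1/2 + u - s, 1/2 + p - 1) ->
  K (- (1/2) - v, 1/2 + q) -> K (- (1/2) - v + 1, 1/2 + q - b) ->
  K (- (1/2) - v + d, 1/2 + q - 1) ->
  forall A, area K = A%:E -> config R K A t s b d u p v q.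
Proof.
move=> cK mK sK X X1 X2 Y Y1 Y2 A aK.
have decK p0 z0 z1 z2 z3 z4 : K z0 -> K z1 -> K z2 -> K z3 -> K z4 -> p0 != (0, 0) ->
    [/\ cross z1 p0 <= cross z0 p0, cross z2 p0 <= cross z1 p0,
        cross z3 p0 <= cross z2 p0, cross z4 p0 <= cross z3 p0 &
        - cross z0 p0 <= cross z4 p0] -> decagon R z0 z1 z2 z3 z4 <= A.
  move=> K0 K1 K2 K3 K4 pn hp; rewrite -lee_fin -aK.
  exact: (area_ge_decagon R K p0).
split => //; first exact: octagon_le sK decK.
move=> z0 z1 z2 z3 z4 K0 K1 K2 K3 K4 [h0 h1 h2 h3 h4].
(* [cross z (1, 0)] is [- z.2], so increasing heights become decreasing cross products. *)
apply: (decK (1, 0)) => //; first by apply/eqP => -[] /eqP; rewrite oner_eq0.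
by rewrite /cross /=; split; lra.
Qed.

Definition shift_in E1 E2 z (x y : R) : pt :=
  padd z (padd (pscale x E1) (pscale y E2)).

Lemma area_ge1_of_triangles K (E1 E2 A B C D : pt) (a b c d : R) :
  Defs.convex_set K -> compact K -> cross E1 E2 = 1 ->
  0 < a -> 0 < b -> 0 < c -> 0 < d -> a + b = 1 -> c + d = 1 -> a <= c -> b <= c ->
  let at_ := shift_in E1 E2 in
  K A -> K (at_ A 1 (a / c)) -> K (at_ A (d / b) 1) ->
  K C -> K (at_ C (-1) (- (a / c))) -> K (at_ C (- (d / b)) (-1)) ->
  K B -> K (at_ B (-1) (b / c)) -> K (at_ B (- (d / a)) 1) ->
  K D -> K (at_ D 1 (- (b / c))) -> K (at_ D (d / a) (-1)) ->
  (1%:E <= area K)%E.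
Proof.
move=> cvK cK E12 a0 b0 c0 d0 ab cd ac bc at_ KA KA1 KA2 KC KC1 KC2 KB KB1 KB2 KD KD1 KD2.
have [S [cvS mS sS leS SK]] := symmetrization _ K (padd A C) (padd B D) cvK cK.
apply: le_trans leS.
pose N := linmap R E1.1 E2.1 E1.2 E2.2.
have aN : area_preserving R N by apply: area_preserving_linmap; rewrite -E12 /cross; ring.
have [mS' aS'] := aN _ mS; rewrite -aS'.
set S' := N @^-1` S in mS' aS' *.
have [->|afin] := eqVneq (area S') +oo%E; first exact: leey.
have area0 : (0 <= area S')%E by apply: integral_ge0.
have aE : area S' = (fine (area S'))%:E.
  by rewrite fineK// ge0_fin_numE// ltey.
rewrite aE lee_fin.
(* Half-differences of matching vertices form translates of the triangles at [C] and [D], whose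
   corners are [X] and [Y]; [cross _ E2] and [cross E1 _] read off the coordinates with respect to
   [E1] and [E2]. *)
pose X := pscale 2^-1 (psub C A); pose Y := pscale 2^-1 (psub D B).
have NE (x y : R) (z : pt) : cross z E2 = x -> cross E1 z = y -> N (x, y) = z.
  move=> <- <-; rewrite [RHS]surjective_pairing -[z.1]mulr1 -[z.2]mulr1 -E12.
  by rewrite /N/linmap/cross/=; congr pair; ring.
have hS (x y : R) (z w : pt) : K z -> K w -> padd z w = padd A C \/ padd z w = padd B D ->
    cross (pscale 2^-1 (psub z w)) E2 = x -> cross E1 (pscale 2^-1 (psub z w)) = y ->
    S' (x, y).
  by move=> Kz Kw zw ex ey; rewrite /S'/= (NE _ _ _ ex ey); apply: SK.
have cl (z w : pt) (x y x' y' : R) : cross (pscale 2^-1 (psub (at_ z x y) (at_ w x' y'))) E2 =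
    cross (pscale 2^-1 (psub z w)) E2 + (x - x') / 2.
  have -> (r : R) : r / 2 = r / 2 * cross E1 E2 by rewrite E12 mulr1.
  by rewrite /at_/shift_in/padd/psub/pscale/cross/=; field.
have cr (z w : pt) (x y x' y' : R) : cross E1 (pscale 2^-1 (psub (at_ z x y) (at_ w x' y'))) =
    cross E1 (pscale 2^-1 (psub z w)) + (y - y') / 2.
  have -> (r : R) : r / 2 = r / 2 * cross E1 E2 by rewrite E12 mulr1.
  by rewrite /at_/shift_in/padd/psub/pscale/cross/=; field.
have at0 (z : pt) : at_ z 0 0 = z.
  by rewrite /at_/shift_in/padd/pscale/= !mul0r !addr0; case: z.
have addat (z w : pt) (x y x' y' : R) : x + x' = 0 -> y + y' = 0 ->
    padd (at_ z x y) (at_ w x' y') = padd z w.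
  move=> /eqP; rewrite addr_eq0 => /eqP-> /eqP; rewrite addr_eq0 => /eqP->.
  by rewrite /at_/shift_in/padd/pscale/=; congr pair; ring.
pose u := cross X E2 - 1/2; pose p := cross E1 X - 1/2.
pose v := - (1/2) - cross Y E2; pose q := cross E1 Y - 1/2.
have cfg : config R S' (fine (area S')) (a / c) (d / b) (b / c) (d / a) u p v q.
  apply: config_of_symmetric => //.
  - exact: convex_linmap.
  - exact: centrally_symmetric_linmap.
  - by apply: (hS _ _ C A) => //; [left; rewrite /padd; congr pair; ring|rewrite /u; field|rewrite /p; field].
  - apply: (hS _ _ _ _ KC1 KA1); rewrite ?cl ?cr.
    + by left; rewrite addat ?subrr ?addNr//; rewrite /padd; congr pair; ring.
    + by rewrite /u; field.
    + by rewrite /p; field; rewrite gt_eqF.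
  - apply: (hS _ _ _ _ KC2 KA2); rewrite ?cl ?cr.
    + by left; rewrite addat ?subrr ?addNr//; rewrite /padd; congr pair; ring.
    + by rewrite /u; field; rewrite gt_eqF.
    + by rewrite /p; field.
  - by apply: (hS _ _ D B) => //; [right; rewrite /padd; congr pair; ring|rewrite /v; field|rewrite /q; field].
  - apply: (hS _ _ _ _ KD1 KB1); rewrite ?cl ?cr.
    + by right; rewrite addat ?subrr ?addNr//; rewrite /padd; congr pair; ring.
    + by rewrite /v; field.
    + by rewrite /q; field; rewrite gt_eqF.
  - apply: (hS _ _ _ _ KD2 KB2); rewrite ?cl ?cr.
    + by right; rewrite addat ?subrr ?addNr//; rewrite /padd; congr pair; ring.
    + by rewrite /v; field; rewrite gt_eqF.
    + by rewrite /q; field.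
apply: (config_bound _ _ _ _ _ _ _ _ _ _ _ cfg).
- by rewrite divr_ge0// ltW.
- by rewrite ler_pdivrMr// mul1r.
- by rewrite divr_ge0// ltW.
- by rewrite ler_pdivrMr// mul1r; lra.
- by rewrite divr_ge0// ltW.
- by rewrite ler_pdivrMr// mul1r.
- by rewrite divr_ge0// ltW.
- by rewrite ler_pdivrMr// mul1r; lra.
- by rewrite -mulrDl addrC ab ler_pdivlMr// mul1r; lra.
- by rewrite ler_pM2r ?invr_gt0// => h; rewrite ler_pM2l// lef_pV2.
- by rewrite ler_pM2r ?invr_gt0// => h; rewrite ler_pM2l// lef_pV2.
Qed.

End four_triangles.

(** * Covers and their triangles *)

Section covers.
Variable R : realType.
Local Notation pt := (R^o * R^o)%type.
Implicit Types (K : set pt) (z w x y : pt) (p : 'I_4 -> pt).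

Lemma quadP p z : quad p z <-> exists a0 a1 a2 a3 : R,
  [/\ 0 <= a0, 0 <= a1, 0 <= a2 & 0 <= a3] /\ a0 + a1 + a2 + a3 = 1 /\
  z = padd (pscale a0 (p 0)) (padd (pscale a1 (p 1))
        (padd (pscale a2 (p 2%:R)) (pscale a3 (p 3%:R)))).
Proof.
have p0 y : padd y (0, 0) = y by case: y => y1 y2; rewrite /padd/= !addr0.
split; last first.
  move=> [a0 [a1 [a2 [a3 [[h0 h1 h2 h3] [s ->]]]]]].
  exists [:: a0; a1; a2; a3]; split=> //=; first by rewrite h0 h1 h2 h3.
    by rewrite !big_cons big_nil addr0 !addrA.
  by rewrite p0.
move=> [l [sl al s1 ->]].
case: l sl al s1 => [|a0 [|a1 [|a2 [|a3 [|a4 l]]]]] //= _ /and5P[h0 h1 h2 h3 _].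
rewrite !big_cons big_nil addr0 !addrA p0 => s.
by exists a0, a1, a2, a3.
Qed.

Lemma quad_vertex p : [/\ quad p (p 0), quad p (p 1), quad p (p 2%:R) & quad p (p 3%:R)].
Proof.
have e (a b c d : R) : padd (pscale a (p 0)) (padd (pscale b (p 1))
   (padd (pscale c (p 2%:R)) (pscale d (p 3%:R)))) =
  (a * (p 0).1 + b * (p 1).1 + c * (p 2%:R).1 + d * (p 3%:R).1,
   a * (p 0).2 + b * (p 1).2 + c * (p 2%:R).2 + d * (p 3%:R).2).
  by rewrite /padd/pscale/= !addrA.
split; apply/quadP;
  [exists 1, 0, 0, 0 | exists 0, 1, 0, 0 | exists 0, 0, 1, 0 | exists 0, 0, 0, 1];
  (split; first by split; rewrite ?ler01 ?lexx); (split; first by rewrite ?addr0 ?add0r);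
  by rewrite e [LHS]surjective_pairing !mul0r !mul1r ?addr0 ?add0r.
Qed.

Lemma dot_quad_le p x (m : R) : dot x (p 0) <= m -> dot x (p 1) <= m ->
  dot x (p 2%:R) <= m -> dot x (p 3%:R) <= m -> forall y, quad p y -> dot x y <= m.
Proof.
move=> h0 h1 h2 h3 y /quadP[a0 [a1 [a2 [a3 [[g0 g1 g2 g3] [s ->]]]]]].
rewrite -[m]mul1r -s !mulrDl.
have -> : dot x (padd (pscale a0 (p 0)) (padd (pscale a1 (p 1))
   (padd (pscale a2 (p 2%:R)) (pscale a3 (p 3%:R))))) =
   a0 * dot x (p 0) + a1 * dot x (p 1) + a2 * dot x (p 2%:R) + a3 * dot x (p 3%:R).
  by rewrite /dot/padd/pscale/=; ring.
by rewrite !lerD// ler_wpM2l.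
Qed.

Lemma dot_le_Qnorm p x y : quad p y -> dot x y <= Qnorm (quad p) x.
Proof.
move=> Qy; apply: ub_le_sup; last by exists y.
pose m := Num.max (Num.max (dot x (p 0)) (dot x (p 1))) (Num.max (dot x (p 2%:R)) (dot x (p 3%:R))).
by exists m => _ [w Qw <-]; apply: (dot_quad_le p) Qw; rewrite /m !le_max lexx ?orbT.
Qed.

Lemma Qnorm_eq p x z (m : R) : quad p z -> dot x z = m ->
  dot x (p 0) <= m -> dot x (p 1) <= m -> dot x (p 2%:R) <= m -> dot x (p 3%:R) <= m ->
  Qnorm (quad p) x = m.
Proof.
move=> Qz xz h0 h1 h2 h3; apply/eqP; rewrite eq_le -[X in _ && (X <= _)]xz dot_le_Qnorm// andbT.
apply: ge_sup; first by exists (dot x z); exists z.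
by move=> _ [y Qy <-]; exact: (dot_quad_le p).
Qed.

Lemma hull3 z0 z1 z2 : [/\ hull [:: z0; z1; z2] z0, hull [:: z0; z1; z2] z1 &
  hull [:: z0; z1; z2] z2].
Proof.
split; [exists [:: 1; 0; 0]|exists [:: 0; 1; 0]|exists [:: 0; 0; 1]];
  (split=> //=; rewrite ?big_cons ?big_nil ?lexx ?ler01 ?addr0 ?add0r//);
  rewrite /padd/pscale/= !mul0r !mul1r ?addr0 ?add0r; exact: surjective_pairing.
Qed.

Lemma hull2 z0 z1 : hull [:: z0; z1] z0 /\ hull [:: z0; z1] z1.
Proof.
split; [exists [:: 1; 0]|exists [:: 0; 1]];
  (split=> //=; rewrite ?big_cons ?big_nil ?lexx ?ler01 ?addr0 ?add0r//);
  rewrite /padd/pscale/= !mul0r !mul1r ?addr0 ?add0r; exact: surjective_pairing.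
Qed.

Definition normal_of_norm p x (m : R) := outward_normal_dir p x /\ Qnorm (quad p) x = m.

(** Traversing the edge vectors [x], [y], [-(x + y)] in the other cyclic order gives the point
    reflection of the triangle, which is therefore also [Q]-normal. The second alternative is the
    degenerate triangle, a segment. *)
Lemma Qcover_pair p K x y (mx my mz : R) : Qcover p K ->
  normal_of_norm p x mx -> normal_of_norm p y my -> mx + my + mz = 1 ->
  (cross x y != 0 /\ normal_of_norm p (popp R (padd x y)) mz) \/
    (y = popp R x /\ mz = 0) ->
  exists A C, [/\ K A, K (psub A x) & K (padd A y)] /\
    [/\ K C, K (padd C x) & K (psub C y)].
Proof.
move=> [_ [triK segK]] [nx qx] [ny qy] m1.
have s0 : psub (0, 0) (popp R x) = x.
  by rewrite /psub/popp/= !add0r !opprK -surjective_pairing.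
have s1 : psub y (0, 0) = y.
  by rewrite /psub/popp/= !subr0 -surjective_pairing.
have s2 : psub (popp R x) y = popp R (padd x y).
  by rewrite /psub/popp/padd/= !opprD.
have s3 : psub x (0, 0) = x.
  by rewrite /psub/= !subr0 -surjective_pairing.
have s4 : psub (popp R y) x = popp R (padd x y).
  by rewrite /psub/popp/padd/=; congr pair; ring.
have s5 : psub (0, 0) (popp R y) = y.
  by rewrite /psub/popp/= !add0r !opprK -surjective_pairing.
have tA t : padd (popp R x) t = psub t x by rewrite /padd/psub/popp/= addrC [X in (_, X)]addrC.
have tC t : padd (popp R y) t = psub t y by rewrite /padd/psub/popp/= addrC [X in (_, X)]addrC.
have t0 t : padd (0, 0) t = t by rewrite /padd/= !add0r -surjective_pairing.
have tx t z : padd z t = padd t z by rewrite /padd/= addrC [X in (_, X)]addrC.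
move=> [[xy [nz qz]]|[yx mz0]].
  have [|t tK] := triK (popp R x) (0, 0) y.
    split; last by rewrite s0 s1 s2 qx qy qz.
    by move: xy; congr (_ != 0); rewrite /cross/psub/popp/=; ring.
  have [|t' tK'] := triK (0, 0) x (popp R y).
    split; last by rewrite s3 s4 s5 qx qy qz; do 3!(split=> //); rewrite addrAC.
    by rewrite -oppr_eq0; move: xy; congr (_ != 0); rewrite /cross/psub/popp/=; ring.
  exists t, t'; split; split.
  - by apply: tK; exists (0, 0); [case: (hull3 (popp R x) (0, 0) y)|].
  - by apply: tK; exists (popp R x); [case: (hull3 (popp R x) (0, 0) y)|].
  - by apply: tK; exists y; [case: (hull3 (popp R x) (0, 0) y)|].
  - by apply: tK'; exists (0, 0); [case: (hull3 (0, 0) x (popp R y))|].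
  - by apply: tK'; exists x; [case: (hull3 (0, 0) x (popp R y))|].
  - by apply: tK'; exists (popp R y); [case: (hull3 (0, 0) x (popp R y))|].
have [|t tK] := segK (popp R x) (0, 0).
  rewrite /Qnormal_segment s0.
  have -> : psub (popp R x) (0, 0) = y by rewrite /psub/= !subr0 yx.
  by rewrite qx qy -[RHS]m1 mz0 addr0.
have [h1 h2] := hull2 (popp R x) (0, 0).
have Kt : K t by apply: tK; exists (0, 0).
have Ktx : K (psub t x) by apply: tK; exists (popp R x).
have e : padd t (popp R x) = psub t x by [].
have e' : padd (psub t x) x = t.
  by rewrite /padd/psub/= !subrK -surjective_pairing.
(* A segment is a translate of its reflection, so its other endpoint serves as [C]. *)
exists t, (psub t x); rewrite yx e e'; split; split => //.
by rewrite (_ : psub _ _ = t)// -[RHS]e' /psub/padd/popp/= !opprK.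
Qed.

End covers.

(** * The triangles given by the normals of a quadrilateral *)

Section frames.
Variable R : realType.
Local Notation pt := (R^o * R^o)%type.
Implicit Types (K : set pt) (z w x y : pt) (p : 'I_4 -> pt).

Definition comb (E1 E2 : pt) (s t : R) : pt := padd (pscale s E1) (pscale t E2).

(* E1 and E2 are the diagonals and O is their intersection point, which splits
   them into lengths a, b and c, d; the four vectors are the outward normals of
   the sides. *)
Record frame p (O E1 E2 : pt) (a b c d : R) : Prop := Frame {
  frame_cross : cross E1 E2 = 1;
  frame_pos : [/\ 0 < a, 0 < b, 0 < c & 0 < d];
  frame_sum : a + b = 1 /\ c + d = 1;
  frame_normal : forall l, 0 < l ->
    let n := comb E1 E2 in
    let is_normal x m := normal_of_norm R p x (dot x O + m) in
    [/\ is_normal (n (- (l * c)) (- (l * a))) (l * (a * c)),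
        is_normal (n (l * c) (- (l * b))) (l * (b * c)),
        is_normal (n (l * d) (l * b)) (l * (b * d)) &
        is_normal (n (- (l * d)) (l * a)) (l * (a * d))];
}.

Lemma frame_rot p O E1 E2 a b c d :
  frame p O E1 E2 a b c d -> frame p O E2 (popp R E1) c d b a.
Proof.
case=> E12 [a0 b0 c0 d0] [ab cd] nE; split.
- by rewrite -E12 /cross/popp/=; ring.
- by split.
- by rewrite [b + a]addrC.
move=> l /nE/=[n0 n1 n2 n3].
have e s t : comb E2 (popp R E1) s t = comb E1 E2 (- t) s.
  by rewrite /comb/padd/pscale/popp/=; congr pair; ring.
rewrite !e !opprK [c * b]mulrC [d * b]mulrC [d * a]mulrC [c * a]mulrC.
by split.
Qed.

(** At most three quarter turns bring the largest of the four lengths to the third place. *)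
Lemma frame_max p O E1 E2 a b c d : frame p O E1 E2 a b c d ->
  exists E1' E2' a' b' c' d',
    [/\ frame p O E1' E2' a' b' c' d', a' <= c' & b' <= c'].
Proof.
move=> f0; have f1 := frame_rot _ _ _ _ _ _ _ _ f0.
have f2 := frame_rot _ _ _ _ _ _ _ _ f1; have f3 := frame_rot _ _ _ _ _ _ _ _ f2.
have [ab cd] := frame_sum _ _ _ _ _ _ _ _ f0.
have use E1' E2' a' b' c' d' : frame p O E1' E2' a' b' c' d' -> a' <= c' -> b' <= c' ->
    exists E1' E2' a' b' c' d', [/\ frame p O E1' E2' a' b' c' d', a' <= c' & b' <= c'].
  by move=> f h1 h2; exists E1', E2', a', b', c', d'.
have [h1|/ltW h1] := lerP a b; have [h2|/ltW h2] := lerP c d.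
- have [h3|/ltW h3] := lerP b d; first by apply: (use _ _ _ _ _ _ f2); lra.
  by apply: (use _ _ _ _ _ _ f1); lra.
- have [h3|/ltW h3] := lerP b c; first by apply: (use _ _ _ _ _ _ f0); lra.
  by apply: (use _ _ _ _ _ _ f1); lra.
- have [h3|/ltW h3] := lerP a d; first by apply: (use _ _ _ _ _ _ f2); lra.
  by apply: (use _ _ _ _ _ _ f3); lra.
- have [h3|/ltW h3] := lerP a c; first by apply: (use _ _ _ _ _ _ f0); lra.
  by apply: (use _ _ _ _ _ _ f3); lra.
Qed.

Lemma area_ge1_of_Qcover p O E1 E2 a b c d K :
  frame p O E1 E2 a b c d -> a <= c -> b <= c -> Qcover p K ->
  (1%:E <= area K)%E.
Proof.
case=> E12 [a0 b0 c0 d0] [ab cd] nE ac bc covK.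
have [[cvK [cK _]] _] := covK.
have ic : 0 < c^-1 by rewrite invr_gt0.
have ib : 0 < b^-1 by rewrite invr_gt0.
have ia : 0 < a^-1 by rewrite invr_gt0.
have addE s t s' t' : padd (comb E1 E2 s t) (comb E1 E2 s' t') = comb E1 E2 (s + s') (t + t').
  by rewrite /comb/padd/pscale/=; congr pair; ring.
have oppE s t : popp R (comb E1 E2 s t) = comb E1 E2 (- s) (- t).
  by rewrite /popp/comb/padd/pscale/=; congr pair; ring.
have dotN z w : dot (popp R z) w = - dot z w by rewrite /dot/popp/=; ring.
have dotD z z' w : dot (padd z z') w = dot z w + dot z' w by rewrite /dot/padd/=; ring.
have crossE s t s' t' : cross (comb E1 E2 s t) (comb E1 E2 s' t') = s * t' - t * s'.
  by rewrite -[RHS]mulr1 -E12 /cross/comb/padd/pscale/=; ring.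
have subE z s t : psub z (comb E1 E2 s t) = shift_in R E1 E2 z (- s) (- t).
  by rewrite /psub/shift_in/comb/padd/pscale/=; congr pair; ring.
(* These are the four normals with scale factors [1 / c], [1 / b], [1 / c], [1 / a]. Up to the terms
   in [O], which cancel around a triangle, their norms are [a], [d], [b], [d], leaving [c - a] and
   [c - b] for the third edges. *)
pose x1 := comb E1 E2 (-1) (- (a / c)); pose y1 := comb E1 E2 (d / b) 1.
pose x2 := comb E1 E2 1 (- (b / c)); pose y2 := comb E1 E2 (- (d / a)) 1.
have [nx1 nx2] : normal_of_norm R p x1 (dot x1 O + a) /\ normal_of_norm R p x2 (dot x2 O + b).
  have [+ + _ _] := nE _ ic; rewrite mulVf ?gt_eqF//.
  rewrite ![c^-1 * _]mulrC -!mulrA divff ?gt_eqF// !mulr1 => n0 n1.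
  by split.
have ny1 : normal_of_norm R p y1 (dot y1 O + d).
  have [_ _ + _] := nE _ ib; rewrite mulVf ?gt_eqF// [b^-1 * d]mulrC.
  by rewrite mulrA mulVf ?gt_eqF// mul1r.
have ny2 : normal_of_norm R p y2 (dot y2 O + d).
  have [_ _ _ +] := nE _ ia; rewrite mulVf ?gt_eqF// [a^-1 * d]mulrC.
  by rewrite mulrA mulVf ?gt_eqF// mul1r.
have xy1 : popp R (padd x1 y1) = comb E1 E2 (1 - d / b) (a / c - 1).
  by rewrite addE oppE; congr comb; ring.
have xy2 : popp R (padd x2 y2) = comb E1 E2 (d / a - 1) (b / c - 1).
  by rewrite addE oppE; congr comb; ring.
have [||A [C [[KA KA1 KA2] [KC KC1 KC2]]]] := Qcover_pair _ _ _ _ _ _ _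
    (dot (popp R (padd x1 y1)) O + (c - a)) covK nx1 ny1.
- by rewrite dotN dotD; lra.
- move: ac; rewrite le_eqVlt => /predU1P[e|lt_ac]; [right|left].
    have db : d = b by lra.
    rewrite /x1 /y1 e db !divff ?gt_eqF//; split; first by rewrite oppE !opprK.
    by rewrite addE dotN !addNr subrr addr0 /dot/comb/padd/pscale/=; ring.
  split.
    rewrite crossE.
    have -> : -1 * 1 - - (a / c) * (d / b) = - ((c - a) / (c * b)).
      have -> : c - a = c * b - a * d.
        have -> : b = 1 - a by lra.
        have -> : d = 1 - c by lra.
        ring.
      by field; rewrite !gt_eqF.
    by rewrite oppr_eq0 gt_eqF// divr_gt0 ?mulr_gt0 ?subr_gt0.
  (* The scale factor is dictated by the norm [c - a]: the third edge is normal to the second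
     side. *)
  have [|_ + _ _] := nE ((c - a) / (b * c)).
    by rewrite divr_gt0 ?mulr_gt0 ?subr_gt0.
  rewrite xy1.
  have -> : (c - a) / (b * c) * c = 1 - d / b.
    have -> : c - a = b - d by lra.
    by field; rewrite !gt_eqF.
  have -> : - ((c - a) / (b * c) * b) = a / c - 1 by field; rewrite !gt_eqF.
  by have -> : (c - a) / (b * c) * (b * c) = c - a by field; rewrite !gt_eqF.
have [||B [D [[KB KB1 KB2] [KD KD1 KD2]]]] := Qcover_pair _ _ _ _ _ _ _
    (dot (popp R (padd x2 y2)) O + (c - b)) covK nx2 ny2.
- by rewrite dotN dotD; lra.
- move: bc; rewrite le_eqVlt => /predU1P[e|lt_bc]; [right|left].
    have da : d = a by lra.
    rewrite /x2 /y2 e da !divff ?gt_eqF//; split; first by rewrite oppE !opprK.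
    by rewrite addE dotN !addrN addNr addr0 /dot/comb/padd/pscale/=; ring.
  split.
    rewrite crossE.
    have -> : 1 * 1 - - (b / c) * - (d / a) = (c - b) / (c * a).
      have -> : c - b = c * a - b * d.
        have -> : a = 1 - b by lra.
        have -> : d = 1 - c by lra.
        ring.
      by field; rewrite !gt_eqF.
    by rewrite gt_eqF// divr_gt0 ?mulr_gt0 ?subr_gt0.
  have [|+ _ _ _] := nE ((c - b) / (a * c)).
    by rewrite divr_gt0 ?mulr_gt0 ?subr_gt0.
  rewrite xy2.
  have -> : - ((c - b) / (a * c) * c) = d / a - 1.
    have -> : c - b = a - d by lra.
    by field; rewrite !gt_eqF.
  have -> : - ((c - b) / (a * c) * a) = b / c - 1 by field; rewrite !gt_eqF.
  by have -> : (c - b) / (a * c) * (a * c) = c - b by field; rewrite !gt_eqF.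
apply: (area_ge1_of_triangles R K E1 E2 A B C D a b c d) => //=.
- by move: KA1; rewrite /x1 subE !opprK.
- by move: KC2; rewrite /y1 subE.
- by move: KB1; rewrite /x2 subE opprK.
- by move: KD2; rewrite /y2 subE opprK.
Qed.

End frames.

(** * The frame of a quadrilateral with orthonormal diagonals *)

Section quadrilateral.
Variable R : realType.
Local Notation pt := (R^o * R^o)%type.
Implicit Types (K : set pt) (z w x y : pt) (p : 'I_4 -> pt).

Lemma frame_of_vertices p (O E1 E2 : pt) (a b c d : R) :
  E2 = (- E1.2, E1.1) -> dot E1 E1 = 1 ->
  0 < a -> 0 < b -> 0 < c -> 0 < d -> a + b = 1 -> c + d = 1 ->
  p 0 = shift_in R E1 E2 O (- a) 0 -> p 1 = shift_in R E1 E2 O 0 (- c) ->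
  p 2%:R = shift_in R E1 E2 O b 0 -> p 3%:R = shift_in R E1 E2 O 0 d ->
  frame R p O E1 E2 a b c d.
Proof.
move=> E2E E11 a0 b0 c0 d0 ab cd p0 p1 p2 p3; split => //.
  by rewrite -E11 E2E /cross/dot/=; ring.
move=> l l0 n is_normal; have [q0 q1 q2 q3] := quad_vertex R p.
have dotE (s t x y : R) :
    dot (n s t) (shift_in R E1 E2 O x y) = dot (n s t) O + (s * x + t * y).
  rewrite -[s * x + _]mulr1 -[X in _ = _ + _ * X]E11 /n/comb/shift_in E2E.
  by rewrite /dot/padd/pscale/=; ring.
have i1 : 1 + 1 = 2%:R :> 'I_4 by apply: val_inj.
have i2 : 2%:R + 1 = 3%:R :> 'I_4 by apply: val_inj.
have i3 : 3%:R + 1 = 0 :> 'I_4 by apply: val_inj.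
have la : 0 < l * a by rewrite mulr_gt0.
have lb : 0 < l * b by rewrite mulr_gt0.
have lac : 0 < l * (a * c) by rewrite !mulr_gt0.
have lbc : 0 < l * (b * c) by rewrite !mulr_gt0.
have lbd : 0 < l * (b * d) by rewrite !mulr_gt0.
have lad : 0 < l * (a * d) by rewrite !mulr_gt0.
split; split.
- exists 0 => //; exists l => //; rewrite add0r p0 p1 /n E2E.
  by rewrite /comb/shift_in/rotcw/padd/psub/pscale/=; congr pair; ring.
- by apply: (Qnorm_eq _ _ _ _ _ q0); rewrite ?p0 ?p1 ?p2 ?p3 dotE; lra.
- exists 1 => //; exists l => //; rewrite i1 p1 p2 /n E2E.
  by rewrite /comb/shift_in/rotcw/padd/psub/pscale/=; congr pair; ring.
- by apply: (Qnorm_eq _ _ _ _ _ q1); rewrite ?p0 ?p1 ?p2 ?p3 dotE; lra.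
- exists 2%:R => //; exists l => //; rewrite i2 p2 p3 /n E2E.
  by rewrite /comb/shift_in/rotcw/padd/psub/pscale/=; congr pair; ring.
- by apply: (Qnorm_eq _ _ _ _ _ q2); rewrite ?p0 ?p1 ?p2 ?p3 dotE; lra.
- exists 3%:R => //; exists l => //; rewrite i3 p3 p0 /n E2E.
  by rewrite /comb/shift_in/rotcw/padd/psub/pscale/=; congr pair; ring.
- by apply: (Qnorm_eq _ _ _ _ _ q3); rewrite ?p0 ?p1 ?p2 ?p3 dotE; lra.
Qed.

Lemma orthonormal_cases (E1 E2 : pt) :
  dot E1 E1 = 1 -> dot E2 E2 = 1 -> dot E1 E2 = 0 ->
  E2 = (- E1.2, E1.1) \/ E2 = (E1.2, - E1.1).
Proof.
case: E1 E2 => [x y] [e f]; rewrite /dot/= => h1 h2 h3.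
pose k : R := x * f - y * e.
have fE : f = k * x.
  transitivity (f * (x * x + y * y)); first by rewrite h1 mulr1.
  transitivity (k * x + y * (x * e + y * f)); last by rewrite h3 mulr0 addr0.
  by rewrite /k; ring.
have eE : e = - (k * y).
  transitivity (e * (x * x + y * y)); first by rewrite h1 mulr1.
  transitivity (- (k * y) + x * (x * e + y * f)); last by rewrite h3 mulr0 addr0.
  by rewrite /k; ring.
have : k ^+ 2 = 1.
  transitivity (k ^+ 2 * (x * x + y * y)); first by rewrite h1 mulr1.
  by rewrite -h2 eE fE; ring.
move/eqP; rewrite sqrf_eq1 => /orP[] /eqP k1; [left|right];
  by rewrite eE fE k1 ?mul1r ?mulN1r ?opprK.
Qed.

Lemma orthonormal_expansion (E1 E2 w : pt) :
  dot E1 E1 = 1 -> E2 = (- E1.2, E1.1) \/ E2 = (E1.2, - E1.1) ->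
  w = comb R E1 E2 (dot w E1) (dot w E2).
Proof.
rewrite {1}/dot => E11 h; rewrite [LHS]surjective_pairing -[w.1]mulr1 -[w.2]mulr1 -E11.
by case: h => ->; rewrite /comb/dot/padd/pscale/=; congr pair; ring.
Qed.

Lemma frame_of_quad p : convex_quad_ccw p ->
  dot (psub (p 2%:R) (p 0)) (psub (p 3%:R) (p 1)) = 0 ->
  dot (psub (p 2%:R) (p 0)) (psub (p 2%:R) (p 0)) = 1 ->
  dot (psub (p 3%:R) (p 1)) (psub (p 3%:R) (p 1)) = 1 ->
  exists O a b c d, frame R p O (psub (p 2%:R) (p 0)) (psub (p 3%:R) (p 1)) a b c d.
Proof.
move=> ccw; have := ccw 0; have := ccw 1; have := ccw 2%:R; have := ccw 3%:R.
have -> : 3%:R + 1 = 0 :> 'I_4 by apply: val_inj.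
have -> : 3%:R + 2%:R = 1 :> 'I_4 by apply: val_inj.
have -> : 2%:R + 1 = 3%:R :> 'I_4 by apply: val_inj.
have -> : 2%:R + 2%:R = 0 :> 'I_4 by apply: val_inj.
have -> : 1 + 1 = 2%:R :> 'I_4 by apply: val_inj.
have -> : 1 + 2%:R = 3%:R :> 'I_4 by apply: val_inj.
rewrite !add0r; set E1 := psub (p 2%:R) (p 0); set E2 := psub (p 3%:R) (p 1).
move=> c3 c2 c1 c0 E12 E11 E22.
pose a := dot (psub (p 1) (p 0)) E1; pose b := dot (psub (p 2%:R) (p 1)) E1.
pose c := dot (psub (p 0) (p 1)) E2.
have ab : a + b = 1 by rewrite -E11 /a/b/E1/dot/psub/=; ring.
have p2 : p 2%:R = padd (p 0) E1 by rewrite /E1/padd/psub/= !subrKC -surjective_pairing.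
have p3 : p 3%:R = padd (p 1) E2 by rewrite /E2/padd/psub/= !subrKC -surjective_pairing.
have hE := orthonormal_cases _ _ E11 E22 E12.
have p1 : p 1 = padd (p 0) (comb R E1 E2 a (- c)).
  have -> : - c = dot (psub (p 1) (p 0)) E2 by rewrite /c/dot/psub/=; ring.
  rewrite -orthonormal_expansion// /padd/psub/= !subrKC; exact: surjective_pairing.
have bE : b = 1 - a by lra.
exists (padd (p 0) (pscale a E1)), a, b, c, (1 - c).
(* The convexity condition at each corner is [cross E1 E2] times one of the four lengths. Since
   [a + b = 1], the sign of [cross E1 E2] has to be positive. *)
have h0 : 0 < cross E1 E2 * c.
  by move: c0; congr (0 < _); rewrite p2 p1 /comb/cross/padd/pscale/psub/=; ring.
have h1 : 0 < cross E1 E2 * b.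
  by move: c1; congr (0 < _); rewrite bE p3 p2 p1 /comb/cross/padd/pscale/psub/=; ring.
have h2 : 0 < cross E1 E2 * (1 - c).
  by move: c2; congr (0 < _); rewrite p3 p2 p1 /comb/cross/padd/pscale/psub/=; ring.
have h3 : 0 < cross E1 E2 * a.
  by move: c3; congr (0 < _); rewrite p3 p1 /comb/cross/padd/pscale/psub/=; ring.
case: hE => e; last first.
  have k1 : cross E1 E2 = -1 by rewrite e -E11 /cross/dot/=; ring.
  by move: h1 h3; rewrite k1; lra.
have k1 : cross E1 E2 = 1 by rewrite e -E11 /cross/dot/=; ring.
move: h0 h1 h2 h3; rewrite k1 !mul1r => h0 h1 h2 h3.
apply: frame_of_vertices => //; first by lra.
- by rewrite /shift_in/padd/pscale/= [LHS]surjective_pairing; congr pair; ring.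
- by rewrite p1 /comb/shift_in/padd/pscale/=; congr pair; ring.
- by rewrite p2 bE /shift_in/padd/pscale/=; congr pair; ring.
- by rewrite p3 p1 /comb/shift_in/padd/pscale/=; congr pair; ring.
Qed.

End quadrilateral.

(** * The square *)

Section square.
Variable R : realType.
Local Notation pt := (R^o * R^o)%type.
Implicit Types (K : set pt) (z w x y : pt) (p : 'I_4 -> pt).

Definition box c (E1 E2 : pt) z : Prop :=
  [/\ 0 <= dot (psub z c) E1, dot (psub z c) E1 <= 1,
      0 <= dot (psub z c) E2 & dot (psub z c) E2 <= 1].

Section orthonormal.
Variables (c E1 E2 : pt).
Hypotheses (E11 : dot E1 E1 = 1) (E22 : dot E2 E2 = 1) (E12 : dot E1 E2 = 0).

Lemma square_box : square c E1 E2 = box c E1 E2.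
Proof.
apply/seteqP; split=> [z [s [t [/andP[s0 s1] /andP[t0 t1] ->]]]|z [h0 h1 h2 h3]].
  rewrite /box; have -> : dot (psub (padd c (padd (pscale s E1) (pscale t E2))) c) E1 = s.
    transitivity (s * dot E1 E1 + t * dot E1 E2); last by rewrite E11 E12; ring.
    by rewrite /dot/psub/padd/pscale/=; ring.
  have -> : dot (psub (padd c (padd (pscale s E1) (pscale t E2))) c) E2 = t.
    transitivity (s * dot E1 E2 + t * dot E2 E2); last by rewrite E22 E12; ring.
    by rewrite /dot/psub/padd/pscale/=; ring.
  by split.
exists (dot (psub z c) E1), (dot (psub z c) E2); split; rewrite ?h0 ?h2//.
have /(orthonormal_expansion R E1 E2 (psub z c) E11) := orthonormal_cases R _ _ E11 E22 E12.
rewrite /comb => <-.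
by rewrite /padd/psub/= !subrKC -surjective_pairing.
Qed.

Lemma convex_square : Defs.convex_set (square c E1 E2).
Proof.
rewrite square_box => x y [x0 x1 x2 x3] [y0 y1 y2 y3] t /andP[t0 t1].
have e E : dot (psub (padd (pscale (1 - t) x) (pscale t y)) c) E =
    (1 - t) * dot (psub x c) E + t * dot (psub y c) E.
  by rewrite /dot/psub/padd/pscale/=; ring.
have t1' : 0 <= 1 - t by lra.
have le1 (r s : R) : r <= 1 -> s <= 1 -> (1 - t) * r + t * s <= 1.
  by move=> r1 s1; rewrite -[leRHS](subrK t) lerD// ler_piMr.
by split; rewrite e; [apply: addr_ge0; exact: mulr_ge0|exact: le1|
  apply: addr_ge0; exact: mulr_ge0|exact: le1].
Qed.

Lemma continuous_dot E : continuous (fun z => dot (psub z c) E : R^o).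
Proof.
move=> z; apply: cvgD; apply: cvgM; try exact: cvg_cst; apply: cvgB; try exact: cvg_cst.
  exact: cvg_fst.
exact: cvg_snd.
Qed.

Lemma compact_square : compact (square c E1 E2).
Proof.
have -> : square c E1 E2 = (fun st : pt => padd c (padd (pscale st.1 E1) (pscale st.2 E2))) @`
    (`[0, 1]%classic `*` `[0, 1]%classic).
  apply/seteqP; split=> [z [s [t [s01 t01 ->]]]|_ [[s t] [/= s01 t01] <-]].
    by exists (s, t) => //; split; rewrite /= in_itv.
  by move: s01 t01; rewrite !in_itv/= => s01 t01; exists s, t.
apply: continuous_compact; last by apply: compact_setX; exact: segment_compact.
apply: continuous_subspaceT.
by apply: continuous_pair => st; (apply: cvgD; [exact: cvg_cst|
  (apply: cvgD; apply: cvgM); [exact: cvg_fst|exact: cvg_cst|exact: cvg_snd|exact: cvg_cst]]).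
Qed.

Lemma interior_square : interior (square c E1 E2) !=set0.
Proof.
pose m := padd c (padd (pscale (1/2) E1) (pscale (1/2) E2)); exists m.
pose U E := (fun z => dot (psub z c) E : R^o) @^-1` `]0, 1[%classic.
have oU E : open (U E).
  by apply: open_comp => [z _|]; [exact: continuous_dot|exact: interval_open].
have m1 : dot (psub m c) E1 = 1 / 2.
  transitivity (1/2 * dot E1 E1 + 1/2 * dot E1 E2); last by rewrite E11 E12; ring.
  by rewrite /dot/psub/padd/pscale/=; ring.
have m2 : dot (psub m c) E2 = 1 / 2.
  transitivity (1/2 * dot E1 E2 + 1/2 * dot E2 E2); last by rewrite E22 E12; ring.
  by rewrite /dot/psub/padd/pscale/=; ring.
rewrite /interior; apply: (@filterS _ _ _ (U E1 `&` U E2)).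
  rewrite square_box => z []; rewrite /U/= !in_itv/= => /andP[h1 h2] /andP[h3 h4].
  by split; exact: ltW.
apply: open_nbhs_nbhs; split; first exact: openI.
by rewrite /U/=; split; rewrite /= ?m1 ?m2 in_itv/=; apply/andP; split; lra.
Qed.

Lemma area_square : cross E1 E2 = 1 -> area (square c E1 E2) = 1%:E.
Proof.
move=> E12c; have ms := compact_measurable_plane R _ compact_square.
have [mc <-] := area_preserving_translation R c _ ms.
have det : E1.1 * E2.2 - E2.1 * E1.2 = 1 by rewrite -E12c /cross; ring.
have [mN <-] := area_preserving_linmap R _ _ _ _ det _ mc.
have -> : linmap R E1.1 E2.1 E1.2 E2.2 @^-1` (padd c @^-1` square c E1 E2) =
    `[0, 1]%classic `*` `[0, 1]%classic.
  rewrite square_box; apply/seteqP.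
  have e1 (x y : R) : dot (psub (padd c (linmap R E1.1 E2.1 E1.2 E2.2 (x, y))) c) E1 = x.
    transitivity (x * dot E1 E1 + y * dot E1 E2); last by rewrite E11 E12; ring.
    by rewrite /linmap/dot/psub/padd/=; ring.
  have e2 (x y : R) : dot (psub (padd c (linmap R E1.1 E2.1 E1.2 E2.2 (x, y))) c) E2 = y.
    transitivity (x * dot E1 E2 + y * dot E2 E2); last by rewrite E22 E12; ring.
    by rewrite /linmap/dot/psub/padd/=; ring.
  split=> -[x y] /=; rewrite /box e1 e2 !in_itv/=.
    by move=> [-> -> -> ->].
  by move=> [/andP[? ?] /andP[? ?]].
rewrite /area product_measure1E//.
by rewrite /= !lebesgue_measure_itv/= lte_fin ltr01 oppr0 adde0 mule1.
Qed.

End orthonormal.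

Lemma dot_foldr_ge (E : pt) (m : R) (l : seq R) (s : seq pt) : size l = size s ->
  all (fun a => 0 <= a) l -> {in s, forall x, m <= dot x E} ->
  m * (\sum_(a <- l) a) <= dot (foldr (@padd R) (0, 0) [seq pscale a.1 a.2 | a <- zip l s]) E.
Proof.
elim: l s => [|a l IH] [|x s] //=.
  by move=> _ _ _; rewrite big_nil mulr0 /dot/= !mul0r addr0.
move=> [ls] /andP[a0 al] hm; rewrite big_cons mulrDr.
have -> : dot (padd (pscale a x) (foldr (@padd R) (0, 0) [seq pscale a.1 a.2 | a <- zip l s])) E =
  a * dot x E + dot (foldr (@padd R) (0, 0) [seq pscale a.1 a.2 | a <- zip l s]) E.
  by rewrite /dot/padd/pscale/=; ring.
rewrite lerD//; first by rewrite mulrC ler_wpM2l// hm// mem_head.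
by apply: IH => // y ys; apply: hm; rewrite inE ys orbT.
Qed.

Lemma hull_dot_ge (E : pt) (m : R) (s : seq pt) :
  {in s, forall x, m <= dot x E} -> forall z, hull s z -> m <= dot z E.
Proof.
move=> hm z [l [ls l0 l1 ->]].
by have := dot_foldr_ge E m l s ls l0 hm; rewrite l1 mulr1.
Qed.

(** The minimum over the vertices serves as [m]; both bounds are linear and so pass to the hull. *)
Lemma spread_lower_bound (E x0 : pt) (s : seq pt) :
  {in x0 :: s &, forall x y, dot (psub x y) E <= 1} ->
  exists m : R, forall z, hull (x0 :: s) z -> m <= dot z E /\ dot z E <= m + 1.
Proof.
move=> h; have [y ys ymin] : exists2 y, y \in x0 :: s &
    {in x0 :: s, forall x, dot y E <= dot x E}.
  elim: s x0 {h} => [|x1 s IH] x0.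
    by exists x0; rewrite ?mem_head// => x; rewrite inE => /eqP->.
  have [y ys hy] := IH x1.
  have [h|/ltW h] := lerP (dot x0 E) (dot y E).
    exists x0; rewrite ?mem_head// => x; rewrite inE => /predU1P[->//|/hy].
    exact: le_trans.
  by exists y; rewrite ?[y \in _ :: _ :: _]inE ?ys ?orbT// => x; rewrite inE => /predU1P[->|/hy].
exists (dot y E) => z Hz; split; first exact: hull_dot_ge Hz.
have dN w : dot w (popp R E) = - dot w E by rewrite /dot/popp/=; ring.
rewrite -lerN2 -dN; apply: hull_dot_ge Hz => x xs; rewrite dN lerN2.
by have := h x y xs ys; rewrite /dot/psub/=; lra.
Qed.

Lemma fits_square (c E1 E2 x0 : pt) (s : seq pt) :
  dot E1 E1 = 1 -> dot E2 E2 = 1 -> dot E1 E2 = 0 ->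
  {in x0 :: s &, forall x y, dot (psub x y) E1 <= 1} ->
  {in x0 :: s &, forall x y, dot (psub x y) E2 <= 1} ->
  fits (hull (x0 :: s)) (square c E1 E2).
Proof.
move=> E11 E22 E12 /spread_lower_bound[m1 h1] /spread_lower_bound[m2 h2].
(* The lower corner of the bounding box is moved to [c]. *)
exists (psub c (comb R E1 E2 m1 m2)) => _ [z Hz <-]; rewrite square_box//.
have e E : dot (psub (padd z (psub c (comb R E1 E2 m1 m2))) c) E =
   dot z E - (m1 * dot E1 E + m2 * dot E2 E).
  by rewrite /dot/psub/padd/comb/padd/pscale/=; ring.
have E21 : dot E2 E1 = 0 by rewrite -E12 /dot; ring.
have [g1 g2] := h1 z Hz; have [g3 g4] := h2 z Hz.
by split; rewrite e ?E11 ?E22 ?E12 ?E21; lra.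
Qed.

(** As [x + y + z = 0], the product of [x] with [v2 - v0] is [dot x v2 + dot y v0 + dot z v0], and
    each summand is at most the corresponding norm. Exchanging [v0] and [v2] gives the other
    sign. *)
Lemma dot_le1_of_Qlength p x y z (v0 v2 : pt) : quad p v0 -> quad p v2 ->
  padd x (padd y z) = (0, 0) ->
  Qnorm (quad p) x + Qnorm (quad p) y + Qnorm (quad p) z = 1 ->
  dot x (psub v2 v0) <= 1 /\ - dot x (psub v2 v0) <= 1.
Proof.
move=> q0 q2 [e1 e2] s.
have x0 := dot_le_Qnorm R p x v0 q0; have x2 := dot_le_Qnorm R p x v2 q2.
have y0 := dot_le_Qnorm R p y v0 q0; have y2 := dot_le_Qnorm R p y v2 q2.
have z0 := dot_le_Qnorm R p z v0 q0; have z2 := dot_le_Qnorm R p z v2 q2.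
have s0 : dot x v0 + dot y v0 + dot z v0 = 0.
  transitivity ((x.1 + (y.1 + z.1)) * v0.1 + (x.2 + (y.2 + z.2)) * v0.2).
    by rewrite /dot; ring.
  by rewrite e1 e2 !mul0r addr0.
have s2 : dot x v2 + dot y v2 + dot z v2 = 0.
  transitivity ((x.1 + (y.1 + z.1)) * v2.1 + (x.2 + (y.2 + z.2)) * v2.2).
    by rewrite /dot; ring.
  by rewrite e1 e2 !mul0r addr0.
have -> : dot x (psub v2 v0) = dot x v2 - dot x v0 by rewrite /dot/psub/=; ring.
by split; lra.
Qed.

End square.

Section spread.
Variable R : realType.
Local Notation pt := (R^o * R^o)%type.
Implicit Types (p : 'I_4 -> pt).

Lemma Qlength1_spread p (u v w v0 v2 : pt) : quad p v0 -> quad p v2 ->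
  Qnorm (quad p) (psub v u) + Qnorm (quad p) (psub w v) + Qnorm (quad p) (psub u w) = 1 ->
  {in [:: u; v; w] &, forall x y, dot (psub x y) (psub v2 v0) <= 1}.
Proof.
move=> q0 q2 s; set E := psub v2 v0.
have cyc (x y z : pt) : padd (psub y x) (padd (psub z y) (psub x z)) = (0, 0).
  by rewrite /padd/psub/=; congr pair; ring.
have [h1 h1'] := dot_le1_of_Qlength R p _ _ _ _ _ q0 q2 (cyc u v w) s.
have [|h2 h2'] := dot_le1_of_Qlength R p _ _ _ _ _ q0 q2 (cyc v w u).
  by rewrite -s; ring.
have [|h3 h3'] := dot_le1_of_Qlength R p _ _ _ _ _ q0 q2 (cyc w u v).
  by rewrite -s; ring.
have dotN (x y : pt) : - dot (psub x y) E = dot (psub y x) E by rewrite /dot/psub/=; ring.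
have dot0 (x : pt) : dot (psub x x) E = 0 by rewrite /dot/psub/=; ring.
move: h1' h2' h3'; rewrite -/E !dotN => h1' h2' h3'.
by move=> x y; rewrite !inE => /or3P[]/eqP-> /or3P[]/eqP->; rewrite ?dot0.
Qed.

Lemma Qnorm0 p : Qnorm (quad p) (0, 0) = 0.
Proof.
have d0 (y : pt) : dot (0, 0) y = 0 by rewrite /dot/= !mul0r addr0.
by have [q0 _ _ _] := quad_vertex R p; apply: (Qnorm_eq _ _ _ _ _ q0); rewrite d0.
Qed.

End spread.

Theorem theorem5p1 (R : realType) (p : 'I_4 -> (R^o * R^o)%type) :
  convex_quad_ccw p ->
  dot (psub (p 2%:R) (p 0)) (psub (p 3%:R) (p 1)) = 0 ->
  dot (psub (p 2%:R) (p 0)) (psub (p 2%:R) (p 0)) = 1 ->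
  dot (psub (p 3%:R) (p 1)) (psub (p 3%:R) (p 1)) = 1 ->
  (forall K : set ((R^o * R^o)%type), Qcover p K -> (1%:E <= area K)%E) /\
  (forall c : (R^o * R^o)%type,
     Qcover p (square c (psub (p 2%:R) (p 0)) (psub (p 3%:R) (p 1))) /\
     area (square c (psub (p 2%:R) (p 0)) (psub (p 3%:R) (p 1))) = 1%:E).
Proof.
move=> ccw E12 E11 E22.
have [z0 [a [b [c [d f]]]]] := frame_of_quad R p ccw E12 E11 E22.
split=> [K|z].
  have [E1 [E2 [a' [b' [c' [d' [f' ac bc]]]]]]] := frame_max R _ _ _ _ _ _ _ _ f.
  exact: area_ge1_of_Qcover f' ac bc.
have [q0 q1 q2 q3] := quad_vertex R p.
split; last exact: area_square (frame_cross _ _ _ _ _ _ _ _ _ f).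
split; first by split; [exact: convex_square|split;
  [exact: compact_square|exact: interior_square]].
split=> [u v w [_ [_ [_ [_ s]]]]|u v [_ [_ s]]]; apply: fits_square => //.
- exact: Qlength1_spread s.
- exact: Qlength1_spread s.
(* A segment is treated as the triangle [u v v], whose extra edge has norm 0. *)
- have s' : Qnorm (quad p) (psub v u) + Qnorm (quad p) (psub v v) +
      Qnorm (quad p) (psub u v) = 1.
    by rewrite [psub v v]/psub !subrr Qnorm0 addr0.
  have sub x : x \in [:: u; v] -> x \in [:: u; v; v].
    by rewrite !inE => /orP[] ->; rewrite ?orbT.
  by move=> x y /sub xs /sub ys; exact: (Qlength1_spread R p _ _ _ _ _ q0 q2 s').
- have s' : Qnorm (quad p) (psub v u) + Qnorm (quad p) (psub v v) +
      Qnorm (quad p) (psub u v) = 1.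
    by rewrite [psub v v]/psub !subrr Qnorm0 addr0.
  have sub x : x \in [:: u; v] -> x \in [:: u; v; v].
    by rewrite !inE => /orP[] ->; rewrite ?orbT.
  by move=> x y /sub xs /sub ys; exact: (Qlength1_spread R p _ _ _ _ _ q1 q3 s').
Qed.
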